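(* Let $n\ge 0$. Let $X_\bullet$ be a semi-cubical set such that: (1) its graph $G(X_\bullet)$ is simple; (2) $X_\bullet$ is regular, in the sense that each characteristic map $\Box^m\to|X_\bullet|$ is injective; (3) for each $m$ the map $X_m\to\{m\text{-cube subgraphs of }G(X_\bullet)\}$ is an injection. Let $x=\sum_i a_i\sigma_i\in C_n(X_\bullet)=\mathbb{Z}X_n$ be an $n$-cycle. Suppose that $G$ is an $n$-quasimonophobic graph, that $$\alpha\colon G(X_\bullet)\hookrightarrow G$$ is an inclusion of graphs (a graph map injective on vertices), and that the homology class $\alpha_*[x]_{CW}\in H_n(CW^\Box(G))$ is non-trivial. Then the homology class $\alpha_*[x]_{graph}\in H_n(G)$ is non-trivial.
   Context: Graphs are simple and undirected (no loops, no multiple edges). A graph map $f\colon G\to G'$ is a map of vertex sets sending every edge to an edge or to a single vertex; its image $\operatorname{Im}(f)$ is the subgraph of $G'$ with vertex set $f(V(G))$ and only those edges of $G'$ that are images of edges of $G$. $I^n$ denotes the discrete $n$-cube graph, with vertex set $\{0,1\}^n$, two vertices being adjacent iff they differ in exactly one coordinate ($I^0$ is a single vertex). A singular $n$-cube in $G$ is a graph map $\sigma\colon I^n\to G$; it is injective if it is injective on vertices. For $1\le i\le n$, $f_i^-\sigma$ and $f_i^+\sigma$ are the singular $(n-1)$-cubes (the faces of $\sigma$) obtained by fixing the $i$-th coordinate equal to $0$ and $1$ respectively. $\sigma$ is degenerate if $f_i^-\sigma=f_i^+\sigma$ for some $i$. Let $Q_n(G)$ be the free abelian group on singular $n$-cubes,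 with $\partial_n\sigma=\sum_{i=1}^n(-1)^i(f_i^-\sigma-f_i^+\sigma)$, let $D_*(G)\subseteq Q_*(G)$ be the subcomplex generated by degenerate cubes, $C_*(G)=Q_*(G)/D_*(G)$, and $H_n(G)=H_n(C_*(G))$ (discrete cubical homology). A graph map $\alpha$ induces $\alpha_*$ on homology by $\sigma\mapsto\alpha\circ\sigma$. An $n$-cube in $G$ is a subgraph isomorphic to $I^n$; it is rigid if it is an induced subgraph of $G$. A singular $n$-cube is supported by an $n$-cube $Q$ if its image equals $Q$. A rigid $n$-cube $Q$ in $G$ is quasimonophobic if, whenever a noninjective singular $(n+1)$-cube in $G$ has a face $f_i^{\pm}$ supported by $Q$, it has at least one additional face (for a different choice of index and sign) supported by $Q$. $G$ is $n$-quasimonophobic if every $n$-cube in $G$ is rigid and quasimonophobic. $CW^\Box(G)$ is the CW complex obtained by filling in the cubes of $G$: its $n$-cells are solid $n$-cubes in bijection with the subgraphs of $G$ isomorphic to $I^n$, and the faces of the cell of a subgraph $D\cong I^n$ are identified with the cells of the corresponding $(n-1)$-cube subgraphs of $D$. An injective graph map $\alpha\colon G'\to G$ induces an inclusion of CW complexes $CW^\Box(G')\hookrightarrow CW^\Box(G)$ (the cell of $D$ goes to the cell of $\alpha(D)$), hence a map $\alpha_*$ on homology. A semi-cubical set is a functor $X_\bullet\colon\Box_{inj}^{op}\to\mathrm{Sets}$, i.e. sets $X_m$ ($m\ge 0$) with face maps $f_i^\pm\colon X_m\to X_{m-1}$ ($1\le i\le m$) satisfying $f_i^af_j^b=f_{j-1}^bf_i^a$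 for $i<j$. Its graph $G(X_\bullet)$ is its 1-skeleton: vertices $X_0$, edges $X_1$, an edge $e$ joining $f_1^-e$ and $f_1^+e$. $|X_\bullet|$ is the geometric realization, a CW complex with one cell, a solid cube $\Box^m$, for each element of $X_m$. $C_*(X_\bullet)$ is the chain complex with $C_m(X_\bullet)=\mathbb{Z}X_m$ and $\partial\sigma=\sum_i(-1)^i(f_i^-\sigma-f_i^+\sigma)$. An element $\sigma\in X_m$ corresponds to a map $\Box^m_\bullet\to X_\bullet$ from the standard semi-cubical $m$-cube and so yields a graph map $\sigma\colon I^m=G(\Box^m_\bullet)\to G(X_\bullet)$; under the conditions (1)–(2) this is injective and its image is the $m$-cube subgraph associated to $\sigma$ in condition (3). Given an $n$-cycle $x=\sum_i a_i\sigma_i$: regarding $x$ as a cellular cycle of $|X_\bullet|$ gives $[x]\in H_n(|X_\bullet|)$, and $[x]_{CW}\in H_n(CW^\Box(G(X_\bullet)))$ is the image of $[x]$ under the inclusion of CW complexes $|X_\bullet|\hookrightarrow CW^\Box(G(X_\bullet))$ given by conditions (2)–(3) (the cell of $\sigma\in X_m$ goes to the cell of the associated $m$-cube subgraph). Regarding each $\sigma_i$ as a singular $n$-cube $I^n\to G(X_\bullet)$, $\sum_i a_i\sigma_i$ is a cycle in $C_n(G(X_\bullet))$, whose class is $[x]_{graph}\in H_n(G(X_\bullet))$. *)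

(* Defs.v *)
From HB Require Import structures.
From Stdlib Require Import Relations.
From mathcomp Require Import freeg zify.
From mathcomp Require Import all_boot all_order all_algebra perm.
From mathcomp Require Import generic_quotient ring_quotient.
From mathcomp Require Import all_classical all_reals topology normedtype.

Set Implicit Arguments.
Unset Strict Implicit.
Unset Printing Implicit Defensive.

Import Order.TTheory GRing.Theory Num.Theory.
Import numFieldNormedType.Exports.

Local Open Scope classical_set_scope.
Local Open Scope ring_scope.
Local Open Scope quotient_scope.

Section QuotientMap.
Variables (V W : zmodType) (I : zmodClosed V) (J : zmodClosed W).
Variables (f : {additive V -> W}) (fIJ : forall x, x \in I -> f x \in J).

Definition quot_map_fun (c : Quotient.quot I) : Quotient.quot J :=
  \pi_(Quotient.quot J) (f (repr c)).

Lemma quot_map_pi x :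
  quot_map_fun (\pi_(Quotient.quot I) x) = \pi_(Quotient.quot J) (f x).
Proof.
rewrite /quot_map_fun; apply/eqP; rewrite -Quotient.idealrBE -raddfB fIJ //.
by rewrite Quotient.idealrBE reprK.
Qed.

Lemma quot_map_is_additive : zmod_morphism quot_map_fun.
Proof.
move=> c d; rewrite -[c]reprK -[d]reprK -raddfB !quot_map_pi.
by rewrite !raddfB.
Qed.

Definition quot_map : {additive Quotient.quot I -> Quotient.quot J} :=
  HB.pack quot_map_fun (GRing.isZmodMorphism.Build _ _ _ quot_map_is_additive).

End QuotientMap.
Arguments quot_map {V W} I J f fIJ.

Record chain_complex := ChainComplex {
  chain :> nat -> zmodType;
  bd : forall n, {additive chain n.+1 -> chain n};
  bd_bd : forall n (x : chain n.+2), bd n (bd n.+1 x) = 0 }.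
Arguments bd C {n} : rename.

Definition is_cycle (C : chain_complex) n : C n -> bool :=
  match n return C n -> bool with
  | 0 => xpredT
  | m.+1 => fun z => bd C z == 0
  end.

Lemma is_cycle_zmod_closed (C : chain_complex) n : zmod_closed (@is_cycle C n).
Proof.
case: n => [|n] //; split=> [|x y]; rewrite !unfold_in /= ?raddf0 //.
by move=> /eqP xP /eqP yP; rewrite raddfB /= xP yP subr0.
Qed.

HB.instance Definition _ (C : chain_complex) n :=
  GRing.isZmodClosed.Build (C n) (@is_cycle C n) (@is_cycle_zmod_closed C n).

Definition cycle_group (C : chain_complex) n := {z : C n | is_cycle z}.
HB.instance Definition _ (C : chain_complex) n := SubChoice.on (cycle_group C n).
HB.instance Definition _ (C : chain_complex) n := [SubChoice_isSubZmodule of cycle_group C n by <:].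

Definition is_boundary (C : chain_complex) n (z : cycle_group C n) : bool :=
  `[< exists y : C n.+1, bd C y = val z >].

Lemma is_boundary_zmod_closed (C : chain_complex) n : zmod_closed (@is_boundary C n).
Proof.
split=> [|x y /asboolP[a ax] /asboolP[b bY]]; apply/asboolP.
  by exists 0; rewrite !raddf0.
by exists (a - b); rewrite !raddfB /= ax bY.
Qed.

HB.instance Definition _ (C : chain_complex) n := GRing.isZmodClosed.Build (cycle_group C n)
  (@is_boundary C n) (@is_boundary_zmod_closed C n).

Definition boundaries (C : chain_complex) n : zmodClosed (cycle_group C n) :=
  GRing.ZmodClosed.clone _ (@is_boundary C n) _.

Definition homology (C : chain_complex) n : zmodType :=
  Quotient.quot (boundaries C n).

Definition homology_class (C : chain_complex) n (z : cycle_group C n) :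
  homology C n := \pi_(Quotient.quot (boundaries C n)) z.

Record chain_map (C D : chain_complex) := ChainMap {
  chain_map_fun :> forall n, {additive C n -> D n};
  chain_map_bd : forall n (x : C n.+1),
    chain_map_fun n (bd C x) = bd D (chain_map_fun n.+1 x) }.

Section ChainMapComp.
Variables (C D E : chain_complex) (g : chain_map D E) (f : chain_map C D).

Lemma chain_map_comp_bd n (x : C n.+1) :
  (g n \o f n) (bd C x) = bd E ((g n.+1 \o f n.+1) x).
Proof. by rewrite /= !chain_map_bd. Qed.

Definition chain_map_comp : chain_map C E :=
  ChainMap (chain_map_fun := fun n => g n \o f n) chain_map_comp_bd.
End ChainMapComp.

Section HomologyMap.
Variables (C D : chain_complex) (f : chain_map C D) (n : nat).

Lemma cycle_map_subproof (z : cycle_group C n) : is_cycle (f n (val z)).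
Proof.
move: z; case: n => [//|m] [z zP]; rewrite /is_cycle /= -chain_map_bd.
by rewrite (eqP zP) raddf0.
Qed.

Definition cycle_map (z : cycle_group C n) : cycle_group D n :=
  Sub (f n (val z)) (cycle_map_subproof z).

Lemma cycle_map_is_additive : zmod_morphism cycle_map.
Proof. by move=> x y; apply: val_inj; rewrite /= !raddfB. Qed.

HB.instance Definition _ :=
  GRing.isZmodMorphism.Build _ _ cycle_map cycle_map_is_additive.

Lemma cycle_map_boundary (z : cycle_group C n) :
  z \in boundaries C n -> cycle_map z \in boundaries D n.
Proof.
move=> /asboolP[y yz]; apply/asboolP; exists (f n.+1 y).
by rewrite -chain_map_bd yz.
Qed.

Definition homology_map : {additive homology C n -> homology D n} :=
  quot_map (boundaries C n) (boundaries D n) cycle_map cycle_map_boundary.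

End HomologyMap.

(* The paper's f_{i+1}^- and f_{i+1}^+ are [face i false] and [face i true]
   (coordinates are indexed from 0).  The cells form [choiceType]s only so that
   free abelian groups on them can be formed; classically every type is one. *)
Record semicubical := SemiCubical {
  cells :> nat -> choiceType;
  face : forall n, 'I_n.+1 -> bool -> cells n.+1 -> cells n;
  face_face : forall n (i j : 'I_n.+1) a b (x : cells n.+2), (i <= j)%N ->
    face i a (face (lift ord0 j) b x) =
    face j b (face (widen_ord (leqnSn n.+1) i) a x) }.
Arguments face X {n} i a x : rename.

Record semicubical_map (X Y : semicubical) := SemiCubicalMap {
  semicubical_fun :> forall n, X n -> Y n;
  semicubical_fun_face : forall n i a (x : X n.+1),
    semicubical_fun (face X i a x) = face Y i a (semicubical_fun x) }.

Lemma fglift_zmod_morphism (S T : choiceType) (f : S -> {freeg T / int}) :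
  zmod_morphism (fglift f).
Proof. exact: lift_is_additive. Qed.

Lemma free_lift_ext (S : choiceType) (W : zmodType)
    (f g : {additive {freeg S / int} -> W}) :
  (forall x, f << x >> = g << x >>) -> f =1 g.
Proof.
move=> fg z; rewrite -(freeg_sumE z) !raddf_sum; apply: eq_bigr => x _.
by rewrite -[coeff x z]intz -freegU_mulz !raddfMz fg.
Qed.

Section FreeComplex.
Variable X : semicubical.

Definition cube_boundary n (x : X n.+1) : {freeg (X n) / int} :=
  \sum_(i < n.+1) (-1) ^+ i.+1 *: (<< face X i false x >> - << face X i true x >>).

Definition free_bd n : {freeg (X n.+1) / int} -> {freeg (X n) / int} :=
  fglift (@cube_boundary n).
Arguments free_bd : clear implicits.
HB.instance Definition _ n := GRing.isZmodMorphism.Build _ _ (free_bd n)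
  (fglift_zmod_morphism (@cube_boundary n)).

Lemma free_bdU n (x : X n.+1) : free_bd n << x >> = cube_boundary x.
Proof. by rewrite /free_bd liftU scale1r. Qed.

Lemma free_bd_bd n (z : {freeg (X n.+2) / int}) : free_bd n (free_bd n.+1 z) = 0.
Proof.
apply: (@free_lift_ext (X n.+2) _ (free_bd n \o free_bd n.+1) \0) => x /=.
rewrite free_bdU /cube_boundary raddf_sum /=.
pose e := face X.
pose T (i : 'I_n.+1) (j : 'I_n.+2) : {freeg (X n) / int} :=
  (-1) ^+ (i + j) *: (<< e _ i false (e _ j false x) >> - << e _ i true (e _ j false x) >>
   - (<< e _ i false (e _ j true x) >> - << e _ i true (e _ j true x) >>)).
transitivity (\sum_(j < n.+2) \sum_(i < n.+1) T i j).
  apply: eq_bigr => j _; rewrite raddfZsign raddfB /= !free_bdU /cube_boundary.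
  rewrite -sumrB scaler_sumr; apply: eq_bigr => i _.
  rewrite -scalerBr scalerA -exprD /T; congr (_ *: _).
  by rewrite addSn addnS !exprS !mulN1r opprK addnC.
have cancel (i j : 'I_n.+1) : (i <= j)%N ->
    T i (lift ord0 j) = - T j (widen_ord (leqnSn n.+1) i).
  move=> ij; rewrite /T /e !face_face // -scaleNr /= /bump /= add1n addnS exprS mulN1r.
  rewrite addnC; congr (_ *: _).
  rewrite !opprB; move: (<< _ >>) (<< _ >>) (<< _ >>) (<< _ >>) => p q r s.
  by rewrite addrACA [RHS]addrACA; congr (_ + _); exact: addrC.
rewrite exchange_big /= (eq_bigr (fun i : 'I_n.+1 =>
  \sum_(j < n.+2 | (i < j)%N) T i j + \sum_(j < n.+2 | (j <= i)%N) T i j)); last first.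
  move=> i _; rewrite (bigID (fun j : 'I_n.+2 => (i < j)%N)) /=.
  by congr (_ + _); apply: eq_bigl => j; rewrite -leqNgt.
rewrite big_split /=.
have -> : \sum_(i < n.+1) \sum_(j < n.+2 | (i < j)%N) T i j =
    \sum_(i < n.+1) \sum_(j < n.+1 | (i <= j)%N) T i (lift ord0 j).
  apply: eq_bigr => i _; rewrite big_mkcond big_ord_recl /= add0r.
  by rewrite [RHS]big_mkcond; apply: eq_bigr.
have -> : \sum_(i < n.+1) \sum_(j < n.+2 | (j <= i)%N) T i j =
    \sum_(i < n.+1) \sum_(j < n.+1 | (j <= i)%N) T i (widen_ord (leqnSn n.+1) j).
  apply: eq_bigr => i _; rewrite big_mkcond big_ord_recr /= leqNgt ltn_ord /= addr0.
  by rewrite [RHS]big_mkcond; apply: eq_bigr.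
rewrite [X in _ + X](exchange_big_dep predT) //= -big_split big1 // => i _ /=.
by rewrite -big_split big1 // => j ij /=; rewrite cancel // addNr.
Qed.

Definition free_complex : chain_complex := ChainComplex free_bd_bd.

End FreeComplex.
Arguments free_bd : clear implicits.

Section FreeMap.
Variables (X Y : semicubical) (f : semicubical_map X Y).

Definition free_map n : {freeg (X n) / int} -> {freeg (Y n) / int} :=
  fglift (fun x : X n => << f n x >> : {freeg (Y n) / int}).
Arguments free_map : clear implicits.
HB.instance Definition _ n := GRing.isZmodMorphism.Build _ _ (free_map n)
  (fglift_zmod_morphism (fun x : X n => << f n x >> : {freeg (Y n) / int})).

Lemma free_mapU n x : free_map n << x >> = << f n x >>.
Proof. by rewrite /free_map liftU scale1r. Qed.

Lemma free_map_bd n (z : free_complex X n.+1) :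
  free_map n (bd (free_complex X) z) = bd (free_complex Y) (free_map n.+1 z).
Proof.
apply: (@free_lift_ext (X n.+1) _ (free_map n \o free_bd X n)
  (free_bd Y n \o free_map n.+1)) => x /=.
rewrite free_bdU free_mapU free_bdU /cube_boundary raddf_sum.
apply: eq_bigr => i _; rewrite raddfZsign raddfB /=.
by rewrite !free_mapU !semicubical_fun_face.
Qed.

Definition free_chain_map : chain_map (free_complex X) (free_complex Y) :=
  @ChainMap (free_complex X) (free_complex Y) free_map free_map_bd.

End FreeMap.
Arguments free_map {X Y} f n.

Record degenerate_cubical := DegenerateCubical {
  underlying :> semicubical;
  degenerate : forall n, set (underlying n);
  degenerate_face : forall n (x : underlying n.+1), degenerate x ->
    exists i : 'I_n.+1, face underlying i false x = face underlying i true x /\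
      forall j a, j != i -> degenerate (face underlying j a x) }.
Arguments degenerate K {n} : rename.

Section NormalizedComplex.
Variable K : degenerate_cubical.

Definition is_degenerate_chain n (z : {freeg (K n) / int}) : bool :=
  `[< forall x, coeff x z != 0 -> degenerate K x >].

Lemma is_degenerate_chain_zmod_closed n : zmod_closed (@is_degenerate_chain n).
Proof.
split=> [|y z /asboolP yP /asboolP zP]; apply/asboolP => x.
  by rewrite coeff0 eqxx.
rewrite coeffB; case: (eqVneq (coeff x y) 0) => [-> | /yP //].
by rewrite sub0r oppr_eq0 => /zP.
Qed.

HB.instance Definition _ n := GRing.isZmodClosed.Build {freeg (K n) / int}
  (@is_degenerate_chain n) (@is_degenerate_chain_zmod_closed n).

Definition degenerate_chains n : zmodClosed {freeg (K n) / int} :=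
  GRing.ZmodClosed.clone _ (@is_degenerate_chain n) _.

Lemma degenerate_chainU n (x : K n) :
  degenerate K x -> << x >> \in degenerate_chains n.
Proof.
move=> dx; apply/asboolP => y; rewrite coeffU mul1r.
by case: (x =P y) => [<- //|_]; rewrite eqxx.
Qed.

Lemma degenerate_chain_map n (V : zmodType) (J : zmodClosed V)
    (f : {additive {freeg (K n) / int} -> V}) :
  (forall x, degenerate K x -> f << x >> \in J) ->
  forall z, z \in degenerate_chains n -> f z \in J.
Proof.
move=> fJ z /asboolP zP; rewrite -(freeg_sumE z) raddf_sum big_seq_cond.
apply: rpred_sum => x; rewrite andbT mem_dom => /zP dx.
by rewrite -[coeff x z]intz -freegU_mulz raddfMz rpredMz // fJ.
Qed.

Lemma free_bd_degenerate n (z : {freeg (K n.+1) / int}) :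
  z \in degenerate_chains n.+1 -> free_bd K n z \in degenerate_chains n.
Proof.
apply: degenerate_chain_map => x /degenerate_face[i [fi fd]].
rewrite /= free_bdU /cube_boundary; apply: rpred_sum => j _.
have [->|ji] := eqVneq j i; first by rewrite fi subrr scaler0 rpred0.
rewrite -signr_odd scaler_sign.
have P : << face K j false x >> - << face K j true x >> \in degenerate_chains n.
  by rewrite rpredB // degenerate_chainU //; apply: fd.
by case: odd; rewrite ?rpredN.
Qed.

Definition norm_bd n := quot_map (degenerate_chains n.+1) (degenerate_chains n)
  (free_bd K n) (@free_bd_degenerate n).

Lemma norm_bd_bd n x : norm_bd n (norm_bd n.+1 x) = 0.
Proof.
rewrite -[x]reprK /norm_bd /= (quot_map_pi (@free_bd_degenerate n.+1)).
rewrite (quot_map_pi (@free_bd_degenerate n)).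
by rewrite /= free_bd_bd raddf0.
Qed.

Definition normalized_complex : chain_complex := ChainComplex norm_bd_bd.

Definition normalization_map n :
    {additive free_complex K n -> normalized_complex n} :=
  \pi_(Quotient.quot (degenerate_chains n)).

Lemma normalization_map_bd n (z : free_complex K n.+1) :
  normalization_map n (bd (free_complex K) z) =
  bd normalized_complex (normalization_map n.+1 z).
Proof. by rewrite /= (quot_map_pi (@free_bd_degenerate n)). Qed.

Definition normalization : chain_map (free_complex K) normalized_complex :=
  ChainMap normalization_map_bd.

End NormalizedComplex.

Record degenerate_cubical_map (K L : degenerate_cubical) := DegenerateCubicalMap {
  underlying_map :> semicubical_map K L;
  underlying_map_degenerate : forall n (x : K n),
    degenerate K x -> degenerate L (underlying_map n x) }.

Section NormalizedMap.
Variables (K L : degenerate_cubical) (f : degenerate_cubical_map K L).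

Lemma free_map_degenerate n (z : {freeg (K n) / int}) :
  z \in degenerate_chains K n -> free_map f n z \in degenerate_chains L n.
Proof.
apply: degenerate_chain_map => x dx; rewrite /= free_mapU.
exact/degenerate_chainU/underlying_map_degenerate.
Qed.

Definition norm_map n := quot_map (degenerate_chains K n) (degenerate_chains L n)
  (free_map f n) (@free_map_degenerate n).

Lemma norm_map_bd n (x : normalized_complex K n.+1) :
  norm_map n (bd (normalized_complex K) x) =
  bd (normalized_complex L) (norm_map n.+1 x).
Proof.
rewrite -[x]reprK /= (quot_map_pi (@free_bd_degenerate K n)).
rewrite (quot_map_pi (@free_map_degenerate n)).
rewrite (quot_map_pi (@free_map_degenerate n.+1)).
rewrite (quot_map_pi (@free_bd_degenerate L n)).
by congr (\pi_ _ _); exact: (free_map_bd f).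
Qed.

Definition normalized_map :
    chain_map (normalized_complex K) (normalized_complex L) :=
  @ChainMap (normalized_complex K) (normalized_complex L) norm_map norm_map_bd.

End NormalizedMap.

Section Coordinates.
Context {T : Type}.

Definition insert_coord n (i : 'I_n.+1) (a : T) (p : 'I_n -> T) : 'I_n.+1 -> T :=
  fun j => if unlift i j is Some k then p k else a.

Lemma insert_coord_eq n (i : 'I_n.+1) a p : insert_coord i a p i = a.
Proof. by rewrite /insert_coord unlift_none. Qed.

Lemma insert_coord_lift n (i : 'I_n.+1) a p k :
  insert_coord i a p (lift i k) = p k.
Proof. by rewrite /insert_coord liftK. Qed.

Lemma insert_coordC n (i j : 'I_n.+1) a b (p : 'I_n -> T) : (i <= j)%N ->
  insert_coord (lift ord0 j) b (insert_coord i a p) =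
  insert_coord (widen_ord (leqnSn n.+1) i) a (insert_coord j b p).
Proof.
move=> ij; apply: funext => k.
have [l ->|->] := unliftP (lift ord0 j) k; last first.
  rewrite insert_coord_eq.
  have -> : lift ord0 j = lift (widen_ord (leqnSn n.+1) i) j.
    by apply: val_inj; rewrite /= /bump ij.
  by rewrite insert_coord_lift insert_coord_eq.
rewrite insert_coord_lift; have [m ->|->] := unliftP i l; last first.
  have -> : lift (lift ord0 j) i = widen_ord (leqnSn n.+1) i.
    by apply: val_inj; rewrite /= /bump /= add1n ltnNge ij.
  by rewrite !insert_coord_eq.
have -> : lift (lift ord0 j) (lift i m) =
    lift (widen_ord (leqnSn n.+1) i) (lift j m).
  apply: val_inj; rewrite /= /bump /=; move: ij.
  by case: (leqP i m); case: (leqP j m) => /=; lia.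
by rewrite !insert_coord_lift.
Qed.

Lemma insert_coord0 n (p : 'I_n.+1 -> T) :
  insert_coord ord0 (p ord0) (p \o lift ord0) = p.
Proof.
apply: funext => k; have [l ->|->] := unliftP ord0 k.
  by rewrite insert_coord_lift.
by rewrite insert_coord_eq.
Qed.

(* With [flip] the reversal of the interval, these are the symmetries of the
   n-cube: permute the coordinates by s, then reverse those i with b i = true. *)
Definition cube_symmetry (flip : T -> T) n (s : {perm 'I_n}) (b : 'I_n -> bool)
    (p : 'I_n -> T) : 'I_n -> T :=
  fun i => if b i then flip (p (s i)) else p (s i).

End Coordinates.

Record graph := Graph {
  vertex :> Type;
  adj : vertex -> vertex -> Prop;
  adj_sym : forall u v, adj u v -> adj v u;
  adj_irrefl : forall u, ~ adj u u }.
Arguments adj {G} u v : rename.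

Record graph_map (G H : graph) := GraphMap {
  graph_fun :> G -> H;
  graph_fun_adj : forall u v, adj u v ->
    graph_fun u = graph_fun v \/ adj (graph_fun u) (graph_fun v) }.

HB.instance Definition _ G H := gen_eqMixin (graph_map G H).
HB.instance Definition _ G H := gen_choiceMixin (graph_map G H).

Lemma graph_map_ext (G H : graph) (f g : graph_map G H) : f =1 g -> f = g.
Proof.
case: f g => [f fP] [g gP] /= /funext fg; case: _ / fg in gP *.
by congr GraphMap; exact: Prop_irrelevance.
Qed.

Lemma graph_comp_adj (G H K : graph) (g : graph_map H K) (f : graph_map G H) u v :
  adj u v -> (g \o f) u = (g \o f) v \/ adj ((g \o f) u) ((g \o f) v).
Proof.
by move=> /(graph_fun_adj f)[/= ->|/(graph_fun_adj g)]; [left|].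
Qed.

Definition graph_comp (G H K : graph) (g : graph_map H K) (f : graph_map G H) :
  graph_map G K := GraphMap (graph_comp_adj g f).

Record subgraph (G : graph) := Subgraph {
  sub_vertex : set G;
  sub_edge : G -> G -> Prop;
  sub_edge_adj : forall u v, sub_edge u v -> adj u v;
  sub_edge_sym : forall u v, sub_edge u v -> sub_edge v u;
  sub_edge_vertex : forall u v, sub_edge u v -> sub_vertex u }.

Section Image.
Variables (G H : graph) (f : graph_map G H).

Definition image_edge (a b : H) : Prop :=
  adj a b /\ exists u v : G, [/\ adj u v, f u = a & f v = b].

Lemma image_edge_adj a b : image_edge a b -> adj a b.
Proof. by case. Qed.

Lemma image_edge_sym a b : image_edge a b -> image_edge b a.
Proof.
move=> [ab [u [v [uv ua vb]]]]; split; first exact: adj_sym.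
by exists v, u; split=> //; apply: adj_sym.
Qed.

Lemma image_edge_vertex a b : image_edge a b -> range f a.
Proof. by move=> [_ [u [v [_ ua _]]]]; exists u. Qed.

Definition image_graph : subgraph H :=
  Subgraph image_edge_adj image_edge_sym image_edge_vertex.

End Image.

Definition hypercube_adj n (u v : 'I_n -> bool) : Prop := exists! i, u i <> v i.

Lemma hypercube_adj_sym n (u v : 'I_n -> bool) :
  hypercube_adj u v -> hypercube_adj v u.
Proof.
move=> [i [uvi ui]]; exists i; split=> [/esym //|j vuj].
by apply: ui => /esym.
Qed.

Lemma hypercube_adj_irrefl n (u : 'I_n -> bool) : ~ hypercube_adj u u.
Proof. by move=> [i [/(_ erefl)]]. Qed.

Definition hypercube n : graph :=
  Graph (@hypercube_adj_sym n) (@hypercube_adj_irrefl n).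

Lemma insert_coord_hypercube_adj n (i : 'I_n.+1) a (u v : hypercube n) :
  adj u v -> insert_coord i a u = insert_coord i a v :> hypercube n.+1 \/
    @adj (hypercube n.+1) (insert_coord i a u) (insert_coord i a v).
Proof.
move=> [k [uvk uk]]; right; exists (lift i k); split.
  by rewrite !insert_coord_lift.
move=> j; have [l ->|->] := unliftP i j; last by rewrite !insert_coord_eq.
by rewrite !insert_coord_lift => /uk ->.
Qed.

Definition insert_graph_map n (i : 'I_n.+1) (a : bool) :
    graph_map (hypercube n) (hypercube n.+1) :=
  GraphMap (@insert_coord_hypercube_adj n i a).

Lemma cube_symmetry_hypercube_adj n s b (u v : hypercube n) : adj u v ->
  cube_symmetry negb s b u = cube_symmetry negb s b v :> hypercube n \/
  @adj (hypercube n) (cube_symmetry negb s b u) (cube_symmetry negb s b v).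
Proof.
move=> [k [uvk uk]]; right; exists (s^-1%g k); split.
  by rewrite /cube_symmetry permKV; case: (b _) => // /negb_inj.
move=> j uvj; rewrite -(permK s j); congr (_ _); apply: uk => uvsj.
by apply: uvj; rewrite /cube_symmetry uvsj.
Qed.

Definition symmetry_graph_map n (s : {perm 'I_n}) (b : 'I_n -> bool) :
    graph_map (hypercube n) (hypercube n) :=
  GraphMap (@cube_symmetry_hypercube_adj n s b).

Section GraphHomology.
Variable G : graph.

Definition singular_cube n : choiceType := graph_map (hypercube n) G.

Definition singular_face n (i : 'I_n.+1) (a : bool) (s : singular_cube n.+1) :
  singular_cube n := graph_comp s (insert_graph_map i a).

Lemma singular_face_face n (i j : 'I_n.+1) a b (s : singular_cube n.+2) :
  (i <= j)%N -> singular_face i a (singular_face (lift ord0 j) b s) =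
    singular_face j b (singular_face (widen_ord (leqnSn n.+1) i) a s).
Proof. by move=> ij; apply: graph_map_ext => v /=; rewrite insert_coordC. Qed.

Definition singular_cubes : semicubical := SemiCubical singular_face_face.

End GraphHomology.

Definition degenerate_singular (X : semicubical) n : set (X n) :=
  match n return set (X n) with
  | 0 => set0
  | m.+1 => [set x | exists i : 'I_m.+1, face X i false x = face X i true x]
  end.

Lemma degenerate_singular_face (X : semicubical) n (x : X n.+1) :
  degenerate_singular x -> exists i : 'I_n.+1,
    face X i false x = face X i true x /\
    forall j a, j != i -> degenerate_singular (face X j a x).
Proof.
move=> [i xi]; exists i; split=> // j a ji.
case: n x i j xi ji => [|n] x i j xi ji; first by rewrite !ord1 in ji.
case: (ltngtP i j) => ij; last by rewrite (val_inj ij) eqxx in ji.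
- have [j' jE|jE] := unliftP ord0 j; last by rewrite jE in ij.
  have ij' : (i <= j')%N by move: ij; rewrite jE /= /bump add1n.
  have lt_i : (i < n.+1)%N by exact: leq_ltn_trans ij' (ltn_ord j').
  have iE : i = widen_ord (leqnSn n.+1) (Ordinal lt_i) by apply: val_inj.
  by exists (Ordinal lt_i); rewrite jE !face_face // -iE xi.
- have [i' iE|iE] := unliftP ord0 i; last by rewrite iE in ij.
  have ij' : (j <= i')%N by move: ij; rewrite iE /= /bump add1n.
  have lt_j : (j < n.+1)%N by exact: leq_ltn_trans ij' (ltn_ord i').
  have jE : j = widen_ord (leqnSn n.+1) (Ordinal lt_j) by apply: val_inj.
  by exists i'; rewrite jE -!(face_face (i := Ordinal lt_j)) // -iE xi.
Qed.

Definition discrete_cubes (G : graph) : degenerate_cubical :=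
  @DegenerateCubical (singular_cubes G) (@degenerate_singular (singular_cubes G))
    (@degenerate_singular_face (singular_cubes G)).

Definition graph_homology (G : graph) n : zmodType :=
  homology (normalized_complex (discrete_cubes G)) n.

Section GraphHomologyMap.
Variables (G H : graph) (f : graph_map G H).

Definition push_cube n (s : singular_cube G n) : singular_cube H n :=
  graph_comp f s.

Lemma push_cube_face n i a (s : singular_cubes G n.+1) :
  push_cube (face (singular_cubes G) i a s) =
  face (singular_cubes H) i a (push_cube s).
Proof. exact: graph_map_ext. Qed.

Definition push_cubes : semicubical_map (singular_cubes G) (singular_cubes H) :=
  @SemiCubicalMap (singular_cubes G) (singular_cubes H) push_cube push_cube_face.

Lemma push_cubes_degenerate n (s : discrete_cubes G n) :
  degenerate (discrete_cubes G) s -> degenerate (discrete_cubes H) (push_cubes n s).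
Proof.
case: n s => //= n s [i si]; exists i.
transitivity (push_cube (singular_face i true s)); last exact: push_cube_face.
by rewrite -[singular_face i true s]si; symmetry; exact: push_cube_face.
Qed.

Definition discrete_push : degenerate_cubical_map (discrete_cubes G) (discrete_cubes H) :=
  @DegenerateCubicalMap (discrete_cubes G) (discrete_cubes H) push_cubes
    push_cubes_degenerate.

Definition graph_homology_map n : {additive graph_homology G n -> graph_homology H n} :=
  homology_map (normalized_map discrete_push) n.

End GraphHomologyMap.

Definition is_cube (G : graph) n (Q : subgraph G) : Prop :=
  exists phi : hypercube n -> G, [/\ injective phi,
    range phi = sub_vertex Q & forall u v, adj u v <-> sub_edge Q (phi u) (phi v)].

Definition rigid (G : graph) (Q : subgraph G) : Prop :=
  forall u v, sub_vertex Q u -> sub_vertex Q v -> adj u v -> sub_edge Q u v.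

Definition quasimonophobic_cube (G : graph) n (Q : subgraph G) : Prop :=
  forall t : singular_cube G n.+1, ~ injective t ->
  forall i a, image_graph (singular_face i a t) = Q ->
  exists j b, (j, b) <> (i, a) /\ image_graph (singular_face j b t) = Q.

Definition quasimonophobic (n : nat) (G : graph) : Prop :=
  forall Q : subgraph G, is_cube n Q -> rigid Q /\ quasimonophobic_cube n Q.

Section SolidCube.
Variable R : realType.

Definition unit_interval : topologicalType := set_type (`[0, 1]%classic : set R).

Lemma endpoint_subproof (a : bool) : (a%:R : R) \in (`[0, 1]%classic : set R).
Proof. by rewrite inE /= in_itv /=; case: a; rewrite ?lexx ?ler01. Qed.

Definition endpoint (a : bool) : unit_interval :=
  exist _ (a%:R : R) (endpoint_subproof a).

Lemma endpoint_inj : injective endpoint.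
Proof.
by move=> [] [] // /(congr1 set_val) /= /eqP; rewrite ?oner_eq0 // eq_sym oner_eq0.
Qed.

Lemma reverse_subproof (t : unit_interval) :
  (1 - set_val t : R) \in (`[0, 1]%classic : set R).
Proof.
have := set_valP t; rewrite inE /= !in_itv /= => /andP[t0 t1].
by rewrite subr_ge0 t1 lerBlDr lerDl.
Qed.

Definition reverse (t : unit_interval) : unit_interval :=
  exist _ (1 - set_val t) (reverse_subproof t).

Definition solid_cube n : topologicalType :=
  prod_topology (fun _ : 'I_n => unit_interval).

Lemma continuous_solid_cube (T : topologicalType) n (f : T -> solid_cube n) :
  (forall i, continuous (fun x => f x i)) -> continuous f.
Proof.
move=> fc x; apply/cvg_sup => i.
exact: (continuous_comp_initial (w := fun p : 'I_n -> unit_interval => p i) (fc i)).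
Qed.

Lemma insert_endpoint_continuous n (i : 'I_n.+1) a :
  continuous (insert_coord i (endpoint a) : solid_cube n -> solid_cube n.+1).
Proof.
apply: continuous_solid_cube => j.
have [k ->|->] := unliftP i j.
  rewrite (_ : (fun _ => _) = proj k); first exact: proj_continuous.
  by apply: funext => p; rewrite insert_coord_lift.
rewrite (_ : (fun _ => _) = cst (endpoint a)); first exact: cst_continuous.
by apply: funext => p; rewrite insert_coord_eq.
Qed.

Definition insert_endpoint n (i : 'I_n.+1) a :
    continuousType (solid_cube n) (solid_cube n.+1) :=
  mkcts (insert_endpoint_continuous (i := i) (a := a)).

Definition cube_vertex n (v : hypercube n) : solid_cube n := endpoint \o v.

Section SingularHomology.
Variable Y : topologicalType.

Definition top_cube n : choiceType := continuousType (solid_cube n) Y.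

Definition top_face n (i : 'I_n.+1) (a : bool) (u : top_cube n.+1) : top_cube n :=
  u \o insert_endpoint i a.

Lemma top_face_face n (i j : 'I_n.+1) a b (u : top_cube n.+2) : (i <= j)%N ->
  top_face i a (top_face (lift ord0 j) b u) =
  top_face j b (top_face (widen_ord (leqnSn n.+1) i) a u).
Proof.
move=> ij; apply/continuousEP => p /=.
by rewrite /mkcts insert_coordC.
Qed.

Definition top_singular_cubes : semicubical := SemiCubical top_face_face.

Definition top_degenerate n : set (top_singular_cubes n) :=
  [set u : top_cube n | exists i : 'I_n, forall p q : solid_cube n,
    (forall j, j != i -> p j = q j) -> u p = u q].

Lemma top_degenerate_face n (u : top_singular_cubes n.+1) :
  top_degenerate u -> exists i : 'I_n.+1,
    face top_singular_cubes i false u = face top_singular_cubes i true u /\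
    forall j a, j != i -> top_degenerate (face top_singular_cubes j a u).
Proof.
move=> [i ui]; exists i; split=> [|j a ji].
  apply/continuousEP => p /=; apply: ui => j.
  by have [k ->|->] := unliftP i j; rewrite ?eqxx // /mkcts !insert_coord_lift.
have [i' iE|iE] := unliftP j i; last by rewrite iE eqxx in ji.
exists i' => p q pq /=; apply: ui => k.
have [l ->|->] := unliftP j k; last by rewrite /mkcts !insert_coord_eq.
rewrite /mkcts !insert_coord_lift => li; apply: pq.
by apply: contraNneq li => ->; rewrite iE.
Qed.

Definition top_cubes : degenerate_cubical :=
  @DegenerateCubical top_singular_cubes top_degenerate top_degenerate_face.

(* Singular homology, computed with normalized singular cubes. *)
Definition top_homology n : zmodType := homology (normalized_complex top_cubes) n.

End SingularHomology.

Section SingularHomologyMap.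
Variables (Y Z : topologicalType) (h : continuousType Y Z).

Definition top_push_cube n (u : top_cube Y n) : top_cube Z n := h \o u.

Lemma top_push_cube_face n i a (u : top_singular_cubes Y n.+1) :
  top_push_cube (face (top_singular_cubes Y) i a u) =
  face (top_singular_cubes Z) i a (top_push_cube u).
Proof. exact/continuousEP. Qed.

Definition top_push_cubes :
    semicubical_map (top_singular_cubes Y) (top_singular_cubes Z) :=
  @SemiCubicalMap (top_singular_cubes Y) (top_singular_cubes Z)
    top_push_cube top_push_cube_face.

Lemma top_push_cubes_degenerate n (u : top_cubes Y n) :
  degenerate (top_cubes Y) u -> degenerate (top_cubes Z) (top_push_cubes n u).
Proof. by move=> [i ui]; exists i => p q pq /=; rewrite (ui p q). Qed.

Definition top_push : degenerate_cubical_map (top_cubes Y) (top_cubes Z) :=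
  @DegenerateCubicalMap (top_cubes Y) (top_cubes Z) top_push_cubes
    top_push_cubes_degenerate.

Definition top_homology_map n : {additive top_homology Y n -> top_homology Z n} :=
  homology_map (normalized_map top_push) n.

End SingularHomologyMap.

Section Gluing.
Variable cell : nat -> choiceType.

Definition cell_points : topologicalType :=
  {c : {m & cell m} & solid_cube (tag c)}.

Definition cell_point m (s : cell m) (p : solid_cube m) : cell_points :=
  existT (fun c : {m & cell m} => solid_cube (tag c)) (existT cell m s) p.

Variable rel : cell_points -> cell_points -> Prop.

Definition glue_equiv (x y : cell_points) : bool :=
  `[< clos_refl_sym_trans _ rel x y >].

Lemma glue_equiv_class : equiv_class_of glue_equiv.
Proof.
split=> [x|x y|y x z]; first exact/asboolP/rst_refl.
  by apply/asboolP/asboolP => xy; apply: rst_sym.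
move=> /asboolP xy /asboolP yz; apply/asboolP; apply: rst_trans xy yz.
Qed.

Canonical glue_equiv_rel := EquivRelPack glue_equiv_class.

(* The quotient of the disjoint union of solid cubes, one for each cell, by the
   equivalence relation generated by [rel]. *)
Definition glue : topologicalType := quotient_topology {eq_quot glue_equiv}.

Definition glue_pi : cell_points -> glue :=
  \pi_(quotient_topology {eq_quot glue_equiv}).

Lemma glue_piP x y : glue_pi x = glue_pi y <-> clos_refl_sym_trans _ rel x y.
Proof.
split=> [xy|/asboolP xy].
  have {}xy : x = y %[mod {eq_quot glue_equiv}] by exact: xy.
  by apply/asboolP; move/eqmodP: xy.
have {}xy : x = y %[mod {eq_quot glue_equiv}] by apply/eqmodP.
exact: xy.
Qed.

Lemma characteristic_continuous m (s : cell m) :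
  continuous (glue_pi \o cell_point s).
Proof.
move=> p; apply: continuous_comp; last exact: pi_continuous.
exact: existT_continuous.
Qed.

Definition characteristic m (s : cell m) : continuousType (solid_cube m) glue :=
  mkcts (characteristic_continuous (s := s)).

End Gluing.

Section GluingMap.
Variables (cell cell' : nat -> choiceType).
Variables (rel : cell_points cell -> cell_points cell -> Prop).
Variables (rel' : cell_points cell' -> cell_points cell' -> Prop).
Variable h : forall m, cell m -> cell' m.

Definition map_cell_points (x : cell_points cell) : cell_points cell' :=
  cell_point (h (tagged (tag x))) (tagged x).

Hypothesis h_rel : forall x y, rel x y ->
  rel' (map_cell_points x) (map_cell_points y).

Definition glue_map_fun (x : glue rel) : glue rel' :=
  glue_pi rel' (map_cell_points (repr x)).

Lemma glue_map_pi x :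
  glue_map_fun (glue_pi rel x) = glue_pi rel' (map_cell_points x).
Proof.
have : clos_refl_sym_trans _ rel (repr (glue_pi rel x)) x.
  by apply/glue_piP; rewrite /glue_pi reprK.
rewrite /glue_map_fun; move: (repr _) => w wx; apply/glue_piP.
elim: wx => [y z /h_rel yz|y|y z _ yz|y z t _ yz _ zt].
- exact: rst_step.
- exact: rst_refl.
- exact: rst_sym.
- exact: rst_trans yz zt.
Qed.

Lemma glue_map_continuous : continuous glue_map_fun.
Proof.
apply/quotient_continuous.
rewrite (_ : _ \o _ = glue_pi rel' \o map_cell_points); last first.
  by apply: funext => x; exact: glue_map_pi.
move=> x; apply: continuous_comp; last exact: pi_continuous.
apply: (@sigT_continuous _ _ _
  (fun (c : {m & cell m}) p => cell_point (h (tagged c)) p)) => c.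
exact: (@existT_continuous _ (fun c : {m & cell' m} => solid_cube (tag c))
  (existT cell' (tag c) (h (tagged c)))).
Qed.

Definition glue_map : continuousType (glue rel) (glue rel') :=
  mkcts glue_map_continuous.

End GluingMap.

Section Realization.
Variable X : semicubical.

Inductive realization_rel : cell_points X -> cell_points X -> Prop :=
  RealizationFace n (s : X n.+1) (i : 'I_n.+1) a (p : solid_cube n) :
    realization_rel (cell_point (face X i a s) p)
      (cell_point s (insert_coord i (endpoint a) p)).

Definition realization : topologicalType := glue realization_rel.

Definition characteristic_map n (s : X n) : top_cube realization n :=
  characteristic realization_rel s.

Definition regular : Prop := forall n (s : X n), injective (characteristic_map s).

Lemma characteristic_map_face n i a (s : X n.+1) :
  characteristic_map (face X i a s) =
  face (top_singular_cubes realization) i a (characteristic_map s).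
Proof.
apply/continuousEP => p; apply/glue_piP; apply: rst_step.
exact: RealizationFace.
Qed.

Definition characteristic_cubes :
    semicubical_map X (top_singular_cubes realization) :=
  @SemiCubicalMap X (top_singular_cubes realization)
    characteristic_map characteristic_map_face.

(* A cellular cycle, i.e. a cycle of ZX, is sent to the corresponding combination of
   characteristic maps. *)
Definition realization_class n (x : cycle_group (free_complex X) n) :
    top_homology realization n :=
  homology_map (chain_map_comp (normalization (top_cubes realization))
    (free_chain_map characteristic_cubes)) n (homology_class x).

End Realization.

Section CWComplex.
Variable G : graph.

Definition injective_cube n : choiceType :=
  {s : singular_cube G n | `[< injective s >]}.

Lemma injective_comp_subproof m n (s : injective_cube n)
    (g : graph_map (hypercube m) (hypercube n)) :
  injective g -> `[< injective (graph_comp (val s) g) >].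
Proof.
by move=> g_inj; apply/asboolP; apply: inj_comp g_inj; apply/asboolP/(valP s).
Qed.

Lemma insert_graph_map_inj n (i : 'I_n.+1) a : injective (insert_graph_map i a).
Proof.
move=> u v /= uv; apply: funext => j.
by have /(congr1 (@^~ (lift i j))) := uv; rewrite !insert_coord_lift.
Qed.

Lemma symmetry_graph_map_inj n s b : injective (@symmetry_graph_map n s b).
Proof.
move=> u v /= uv; apply: funext => j.
have /(congr1 (@^~ (s^-1%g j))) := uv; rewrite /cube_symmetry permKV.
by case: (b _) => // /negb_inj.
Qed.

Definition injective_face n i a (s : injective_cube n.+1) : injective_cube n :=
  exist _ (graph_comp (val s) (insert_graph_map i a))
    (injective_comp_subproof s (insert_graph_map_inj (i := i) (a := a))).

Definition injective_symmetry n g b (s : injective_cube n) : injective_cube n :=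
  exist _ (graph_comp (val s) (symmetry_graph_map g b))
    (injective_comp_subproof s (symmetry_graph_map_inj (s := g) (b := b))).

(* One solid n-cube is taken for each parametrization I^n -> D of an n-cube
   subgraph D; the parametrizations of D form a single free orbit under the
   symmetries of I^n, so [CWSymmetry] leaves exactly one n-cell for each D. *)
Inductive cw_rel : cell_points injective_cube -> cell_points injective_cube -> Prop :=
  | CWFace n (s : injective_cube n.+1) (i : 'I_n.+1) a (p : solid_cube n) :
      cw_rel (cell_point (injective_face i a s) p)
        (cell_point s (insert_coord i (endpoint a) p))
  | CWSymmetry n (s : injective_cube n) (g : {perm 'I_n}) b (p : solid_cube n) :
      cw_rel (cell_point (injective_symmetry g b s) p)
        (cell_point s (cube_symmetry reverse g b p : solid_cube n)).

Definition cw : topologicalType := glue cw_rel.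

End CWComplex.

Section CWMap.
Variables (G H : graph) (f : graph_map G H) (f_inj : injective f).

Lemma push_injective_subproof n (s : injective_cube G n) :
  `[< injective (graph_comp f (val s)) >].
Proof.
by apply/asboolP; apply: inj_comp f_inj _; apply/asboolP/(valP s).
Qed.

Definition push_injective n (s : injective_cube G n) : injective_cube H n :=
  exist _ (graph_comp f (val s)) (push_injective_subproof s).

Lemma push_injective_rel x y : cw_rel x y ->
  cw_rel (map_cell_points push_injective x) (map_cell_points push_injective y).
Proof.
case=> [n s i a p|n s g b p]; rewrite /map_cell_points /=.
  rewrite (_ : push_injective _ = injective_face i a (push_injective s)).
    exact: CWFace.
  exact/val_inj/graph_map_ext.
rewrite (_ : push_injective _ = injective_symmetry g b (push_injective s)).
  exact: CWSymmetry.
exact/val_inj/graph_map_ext.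
Qed.

Definition cw_map : continuousType (cw G) (cw H) := glue_map push_injective_rel.

End CWMap.

Section Skeleton.
Variable X : semicubical.

Definition same_ends (e e' : X 1) : Prop :=
  (face X ord0 false e = face X ord0 false e' /\
   face X ord0 true e = face X ord0 true e') \/
  (face X ord0 false e = face X ord0 true e' /\
   face X ord0 true e = face X ord0 false e').

Definition simple_skeleton : Prop :=
  (forall e : X 1, face X ord0 false e <> face X ord0 true e) /\
  (forall e e' : X 1, same_ends e e' -> e = e').

Fixpoint vertex_of n : X n -> ('I_n -> bool) -> X 0 :=
  match n return X n -> ('I_n -> bool) -> X 0 with
  | 0 => fun s _ => s
  | m.+1 => fun s v => vertex_of (face X ord0 (v ord0) s) (v \o lift ord0)
  end.

Lemma vertex_ofS n (s : X n.+1) v :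
  vertex_of s v = vertex_of (face X ord0 (v ord0) s) (v \o lift ord0).
Proof. by []. Qed.

Lemma vertex_of_insert n (s : X n.+1) (i : 'I_n.+1) a v :
  vertex_of s (insert_coord i a v) = vertex_of (face X i a s) v.
Proof.
elim: n s i v => [|n IH] s i v.
  by rewrite [i]ord1 /= insert_coord_eq.
have [j ->|->] := unliftP ord0 i; last first.
  rewrite [LHS]vertex_ofS insert_coord_eq; congr vertex_of.
  by apply: funext => k; rewrite /= insert_coord_lift.
have ins : insert_coord (lift ord0 j) a v =
    insert_coord ord0 (v ord0) (insert_coord j a (v \o lift ord0)).
  rewrite -[v in LHS]insert_coord0 insert_coordC //.
  by congr insert_coord; apply: val_inj.
rewrite ins [LHS]vertex_ofS insert_coord_eq.
rewrite (_ : _ \o lift ord0 = insert_coord j a (v \o lift ord0)); last first.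
  by apply: funext => k; rewrite /= insert_coord_lift.
rewrite IH [RHS]vertex_ofS face_face // (_ : widen_ord _ _ = ord0) //.
exact: val_inj.
Qed.

Lemma vertex_of_edge n (s : X n.+1) (i : 'I_n.+1) v :
  exists e : X 1, forall a, face X ord0 a e = vertex_of s (insert_coord i a v).
Proof.
elim: n s i v => [|n IH] s i v.
  by exists s => a; rewrite vertex_of_insert [i]ord1.
have [j ->|->] := unliftP ord0 i.
  have [e eE] := IH (face X ord0 (v ord0) s) j (v \o lift ord0).
  exists e => a; rewrite eE -vertex_of_insert; congr vertex_of.
  rewrite -[v in RHS]insert_coord0 insert_coordC //.
  by congr insert_coord; apply: val_inj.
have [e eE] := IH (face X (lift ord0 ord0) (v ord0) s) ord0 (v \o lift ord0).
exists e => a; rewrite eE -vertex_of_insert; congr vertex_of.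
rewrite insert_coordC // insert_coord0.
by congr insert_coord; apply: val_inj.
Qed.

Hypothesis simpleX : simple_skeleton.

Definition skeleton_adj (u v : X 0) : Prop := exists e : X 1,
  (face X ord0 false e = u /\ face X ord0 true e = v) \/
  (face X ord0 false e = v /\ face X ord0 true e = u).

Lemma skeleton_adj_sym u v : skeleton_adj u v -> skeleton_adj v u.
Proof. by move=> [e [e1|e2]]; exists e; [right|left]. Qed.

Lemma skeleton_adj_irrefl u : ~ skeleton_adj u u.
Proof.
by move=> [e eu]; apply: (simpleX.1 e); case: eu => -[-> ->].
Qed.

Definition skeleton : graph := Graph skeleton_adj_sym skeleton_adj_irrefl.

Lemma cell_cube_adj n (s : X n) (u v : hypercube n) : adj u v ->
  vertex_of s u = vertex_of s v \/
  @adj skeleton (vertex_of s u) (vertex_of s v).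
Proof.
case: n s u v => [|n] s u v; first by move=> [[]].
move=> [i [uvi ui]]; right.
pose w k := u (lift i k).
have uE : u = insert_coord i (u i) w.
  apply: funext => j; have [k ->|->] := unliftP i j.
    by rewrite insert_coord_lift.
  by rewrite insert_coord_eq.
have vE : v = insert_coord i (~~ u i) w.
  apply: funext => j; have [k ->|->] := unliftP i j; last first.
    by rewrite insert_coord_eq; move: uvi; case: (u i); case: (v i).
  rewrite insert_coord_lift /w; apply: contrapT => /nesym /ui /eqP.
  by rewrite (negbTE (neq_lift _ _)).
have [e eE] := vertex_of_edge s i w; exists e.
have <- : face X ord0 (u i) e = vertex_of s u by rewrite eE -uE.
have <- : face X ord0 (~~ u i) e = vertex_of s v by rewrite eE -vE.
by case: (u i); [right|left].
Qed.

Definition cell_cube n (s : X n) : singular_cube skeleton n :=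
  @GraphMap (hypercube n) skeleton (vertex_of s) (@cell_cube_adj n s).

Lemma cell_cube_face n i a (s : X n.+1) :
  cell_cube (face X i a s) = face (singular_cubes skeleton) i a (cell_cube s).
Proof. by apply: graph_map_ext => v; symmetry; exact: vertex_of_insert. Qed.

Definition cell_cubes : semicubical_map X (singular_cubes skeleton) :=
  @SemiCubicalMap X (singular_cubes skeleton) cell_cube cell_cube_face.

Definition graph_class n (x : cycle_group (free_complex X) n) :
    graph_homology skeleton n :=
  homology_map (chain_map_comp (normalization (discrete_cubes skeleton))
    (free_chain_map cell_cubes)) n (homology_class x).

(* For simple and regular X, [cell_cube s] is injective (cf. [cell_cube_inj]),
   so its image is the cube subgraph associated with s. *)
Definition cells_determined_by_cubes : Prop :=
  forall n, injective (fun s : X n => image_graph (cell_cube s)).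

Hypothesis regularX : regular X.

Lemma characteristic_vertex n (s : X n) v :
  characteristic_map s (cube_vertex v) =
  characteristic_map (vertex_of s v) (cube_vertex (fun=> false)).
Proof.
elim: n s v => [|n IH] s v.
  by congr (characteristic_map _ _); apply: funext => -[].
rewrite vertex_ofS -IH characteristic_map_face /=; congr (glue_pi _ (cell_point _ _)).
apply: funext => j; rewrite /mkcts; have [k ->|->] := unliftP ord0 j.
  by rewrite insert_coord_lift.
by rewrite insert_coord_eq.
Qed.

Lemma cell_cube_inj n (s : X n) : `[< injective (cell_cube s) >].
Proof.
apply/asboolP => u v /= uv; have := characteristic_vertex s v.
rewrite -uv -characteristic_vertex => /regularX cuv.
by apply: funext => i; have /(congr1 (@^~ i))/endpoint_inj := cuv.
Qed.

Definition cell_injective_cube n (s : X n) : injective_cube skeleton n :=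
  exist _ (cell_cube s) (cell_cube_inj s).

Lemma cell_injective_cube_rel x y : realization_rel x y ->
  cw_rel (map_cell_points cell_injective_cube x)
    (map_cell_points cell_injective_cube y).
Proof.
case=> n s i a p; rewrite /map_cell_points /=.
rewrite (_ : cell_injective_cube _ = injective_face i a (cell_injective_cube s)).
  exact: CWFace.
by apply: val_inj; exact: cell_cube_face.
Qed.

Definition realization_to_cw : continuousType (realization X) (cw skeleton) :=
  glue_map cell_injective_cube_rel.

Definition cw_class n (x : cycle_group (free_complex X) n) :
    top_homology (cw skeleton) n :=
  top_homology_map realization_to_cw n (realization_class x).

End Skeleton.
End SolidCube.

Arguments top_homology_map {R Y Z} h n.
Arguments cw_map R {G H f} f_inj.
Arguments realization_class R {X n} x.
Arguments cw_class {R X} simpleX regularX {n} x.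

(* Main.v *)
(** Write N(Y) for the normalized singular cubical chains of Y.  Coning towards the centre
    of the solid cube gives a natural subdivision operator sd into N(Y), naturally chain
    homotopic to the projection onto N(Y).  As coning commutes with the symmetries of the
    cube, sd (u o g) = sgn(g) sd u holds exactly, for every symmetry g of the cube.
    Therefore sending an injective singular cube of G to the subdivision of its
    characteristic map, and a noninjective one to 0, depends on an n-cube subgraph only up
    to the orientation of its parametrization.  This is compatible with the boundary in
    degree n: if t is a noninjective singular (n+1)-cube, quasimonophobia makes the faces
    of t supported by a given n-cube Q cancel.  Indeed there are at least two of them.  Two
    faces in different directions supported by Q are matched by a symmetry of the cube and
    cancel, and Q then supports exactly two or four faces, in two directions.  If only two
    opposite faces are supported by Q, they differ by an automorphism of Q moving each
    vertex by at most one step: the identity, a quarter turn in two coordinates, or a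
    reflection, and a reflection would produce further faces supported by Q.
    So a chain of G bounding alpha_* x yields a chain of CW(G) bounding sd (alpha_* x),
    which is homologous to alpha_* x. *)

From HB Require Import structures.
From Stdlib Require Import Relations.
Require Import Defs.
From mathcomp Require Import freeg zify ring lra.
From mathcomp Require Import all_boot all_order all_algebra perm.
From mathcomp Require Import all_classical all_reals topology normedtype.

Set Implicit Arguments.
Unset Strict Implicit.
Unset Printing Implicit Defensive.

Import Order.TTheory GRing.Theory Num.Theory.
Import numFieldNormedType.Exports.

Local Open Scope classical_set_scope.
Local Open Scope ring_scope.

(** * Chains *)

Section IntLift.
Variables (S : choiceType) (V : zmodType) (f : S -> V).

(** [fglift] takes values in a module over the coefficients, so V is viewed as a ℤ-module through
    [zmodule]. *)
Definition zlift (z : {freeg S / int}) : V := fglift (f : S -> zmodule V) z.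

Lemma zlift_is_additive : zmod_morphism zlift.
Proof. exact: (@lift_is_additive int S (zmodule V) f). Qed.

HB.instance Definition _ :=
  GRing.isZmodMorphism.Build _ _ zlift zlift_is_additive.

Lemma zliftU x : zlift << x >> = f x.
Proof. by rewrite /zlift (@liftU int (zmodule V) S f) scale1r. Qed.

End IntLift.

(** Signs become integer multiples [*~], which make sense in any abelian group and pass through
    additive maps. *)
Lemma raddf_cube_boundary (X : semicubical) (V : zmodType) n
    (F : {additive {freeg (X n) / int} -> V}) (x : X n.+1) :
  F (cube_boundary x) = \sum_(i < n.+1)
    (F << face X i false x >> - F << face X i true x >>) *~ (-1) ^+ i.+1.
Proof.
rewrite raddf_sum; apply: eq_bigr => i _.
by rewrite -raddfB -raddfMz -scaler_int intz.
Qed.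

Lemma free_chain_bdU (X : semicubical) n (x : X n.+1) :
  bd (free_complex X) << x >> = cube_boundary x.
Proof. exact: free_bdU. Qed.

Lemma normalization_degenerate (K : degenerate_cubical) n (x : K n) :
  degenerate K x -> normalization K n << x >> = 0.
Proof.
move=> dx; apply/eqP; rewrite -[X in _ == X](raddf0 (normalization K n)).
by rewrite /= -Quotient.idealrBE subr0 degenerate_chainU.
Qed.

Lemma normalization_surj (K : degenerate_cubical) n
    (c : normalized_complex K n) : exists z, c = normalization K n z.
Proof. by exists (repr c); rewrite /= /normalization_map reprK. Qed.

Lemma normalization_eq0 (K : degenerate_cubical) n (z : {freeg (K n) / int}) :
  normalization K n z = 0 -> z \in degenerate_chains K n.
Proof.
rewrite -[RHS](raddf0 (normalization K n)) => /eqP.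
by rewrite /= -Quotient.idealrBE subr0.
Qed.

Lemma normalized_mapE (K L : degenerate_cubical) (f : degenerate_cubical_map K L)
    n (z : free_complex K n) :
  normalized_map f n (normalization K n z) = normalization L n (free_chain_map f n z).
Proof. exact: (quot_map_pi (@free_map_degenerate K L f n)). Qed.

Lemma normalized_complex_ext (K : degenerate_cubical) n (V : zmodType)
    (F G : {additive normalized_complex K n -> V}) :
  (forall x : K n, F (normalization K n << x >>) = G (normalization K n << x >>)) ->
  F =1 G.
Proof.
move=> FG c; have [z ->] := normalization_surj c.
exact: (free_lift_ext (f := F \o normalization K n) (g := G \o normalization K n)).
Qed.

Section NormalizedLift.
Variables (K : degenerate_cubical) (n : nat) (V : zmodType) (f : K n -> V).
Hypothesis f_degenerate : forall x, degenerate K x -> f x = 0.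

Lemma zlift_degenerate z : z \in degenerate_chains K n -> zlift f z = 0.
Proof.
move=> /asboolP zP; rewrite -(freeg_sumE z) raddf_sum big_seq_cond.
rewrite big1 // => x; rewrite andbT mem_dom => /zP dx.
by rewrite -[coeff x z]intz -freegU_mulz raddfMz /= zliftU f_degenerate // mul0rz.
Qed.

Definition nlift_fun (c : normalized_complex K n) : V := zlift f (repr c).

Lemma nlift_funE z : nlift_fun (normalization K n z) = zlift f z.
Proof.
apply/eqP; rewrite -subr_eq0 /nlift_fun -raddfB; apply/eqP/zlift_degenerate.
by rewrite Quotient.idealrBE /= reprK.
Qed.

Lemma nlift_is_additive : zmod_morphism nlift_fun.
Proof.
move=> c d; have [z ->] := normalization_surj c.
have [t ->] := normalization_surj d.
by rewrite -raddfB !nlift_funE raddfB.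
Qed.

Definition nlift : {additive normalized_complex K n -> V} :=
  HB.pack nlift_fun (GRing.isZmodMorphism.Build _ _ _ nlift_is_additive).

Lemma nliftU x : nlift (normalization K n << x >>) = f x.
Proof. by rewrite [LHS]nlift_funE zliftU. Qed.

End NormalizedLift.

(** * Cones and subdivision of solid cubes *)

Section Contraction.
Variable R : realType.
Local Notation I := (unit_interval R).

Lemma contract_to_half_bounds (t x : R) : 0 <= t <= 1 -> 0 <= x <= 1 ->
  0 <= 2^-1 + t * (x - 2^-1) <= 1.
Proof.
move=> /andP[t0 t1] /andP[x0 x1].
have : 0 <= t * x by exact: mulr_ge0.
have : 0 <= t * (1 - x) by rewrite mulr_ge0 // subr_ge0.
by move=> h h'; apply/andP; split; lra.
Qed.

Lemma toward_half_subproof (t x : I) :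
  (2^-1 + set_val t * (set_val x - 2^-1) : R) \in (`[0, 1]%classic : set R).
Proof.
have := set_valP t; have := set_valP x; rewrite inE /= !in_itv /= => xI tI.
exact: contract_to_half_bounds.
Qed.

(** The point at parameter t on the segment from the midpoint 1/2 (t = 0) to x (t = 1). *)
Definition toward_half (t x : I) : I :=
  exist _ (2^-1 + set_val t * (set_val x - 2^-1) : R) (toward_half_subproof t x).

Lemma unit_interval_inj (s t : I) : set_val s = set_val t -> s = t.
Proof. exact: val_inj. Qed.

Lemma set_val_toward_half t x :
  set_val (toward_half t x) = 2^-1 + set_val t * (set_val x - 2^-1) :> R.
Proof. by []. Qed.

Lemma set_val_endpoint a : set_val (endpoint R a) = a%:R :> R.
Proof. by []. Qed.

Lemma set_val_reverse (t : I) : set_val (reverse t) = 1 - set_val t :> R.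
Proof. by []. Qed.

Lemma toward_half0 x y :
  toward_half (endpoint R false) x = toward_half (endpoint R false) y.
Proof.
by apply: unit_interval_inj; rewrite !set_val_toward_half set_val_endpoint !mul0r.
Qed.

Lemma toward_half1 x : toward_half (endpoint R true) x = x.
Proof.
apply: unit_interval_inj.
by rewrite set_val_toward_half set_val_endpoint mul1r addrC subrK.
Qed.

(** Reversal is the affine reflection fixing 1/2; for this reason cones are taken towards the
    centre. *)
Lemma toward_half_reverse t x : toward_half t (reverse x) = reverse (toward_half t x).
Proof.
apply: unit_interval_inj.
by rewrite !(set_val_toward_half, set_val_reverse); field.
Qed.

Lemma continuous_unit_interval (T : topologicalType) (f : T -> I) :
  continuous (fun x => set_val (f x)) -> continuous f.
Proof. exact: (@continuous_comp_initial _ _ _ (set_val : I -> R)). Qed.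

Lemma set_val_continuous : continuous (set_val : I -> R).
Proof. exact: initial_continuous. Qed.

Lemma toward_half_continuous (T : topologicalType) (f g : T -> I) :
  continuous f -> continuous g -> continuous (fun x => toward_half (f x) (g x)).
Proof.
move=> fc gc; apply: continuous_unit_interval => x /=.
have fv : {for x, continuous (fun x => set_val (f x) : R)}.
  by apply: continuous_comp; [exact: fc|exact: set_val_continuous].
have gv : {for x, continuous (fun x => set_val (g x) : R)}.
  by apply: continuous_comp; [exact: gc|exact: set_val_continuous].
apply: cvgD; first exact: cvg_cst.
by apply: cvgM => //; apply: cvgB => //; exact: cvg_cst.
Qed.

Lemma solid_cube_coordinate_continuous n (T : topologicalType) (f : T -> solid_cube R n) j :
  continuous f -> continuous (fun x => f x j).
Proof.
move=> fc x; apply: (@continuous_comp _ _ _ f (fun p : solid_cube R n => p j)).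
  exact: fc.
exact: (@proj_continuous _ (fun _ : 'I_n => I) j).
Qed.

Section Cone.
Variables (m k : nat) (u : top_cube R (solid_cube R m) k).

(** Coordinate 0 is the cone parameter: its face 1 is u, and its face 0 collapses to the centre of
    the cube. *)
Definition cone_fun (p : solid_cube R k.+1) : solid_cube R m :=
  fun j => toward_half (p ord0) (u (fun i => p (lift ord0 i)) j).

Lemma cone_continuous : continuous cone_fun.
Proof.
apply: continuous_solid_cube => j; apply: toward_half_continuous.
  exact: (@proj_continuous _ (fun _ : 'I_k.+1 => I)).
apply: (@solid_cube_coordinate_continuous _ _
  (fun p : solid_cube R k.+1 => u (fun i => p (lift ord0 i)))).
move=> p; apply: (continuous_comp (g := u)); last exact: cts_fun.
apply: continuous_solid_cube => i.
exact: (@proj_continuous _ (fun _ : 'I_k.+1 => I)).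
Qed.

Definition cone_cube : top_cube R (solid_cube R m) k.+1 := mkcts cone_continuous.

End Cone.

Lemma cone_face0 m k (u : top_cube R (solid_cube R m) k) :
  face (top_singular_cubes R _) ord0 true (cone_cube u) = u.
Proof.
apply/continuousEP => p; apply: funext => j; rewrite /= /mkcts /cone_fun /=.
rewrite insert_coord_eq toward_half1; congr (u _ j).
by apply: funext => i; rewrite insert_coord_lift.
Qed.

Lemma cone_face_lift m k (u : top_cube R (solid_cube R m) k.+1) i a :
  face (top_singular_cubes R _) (lift ord0 i) a (cone_cube u) =
  cone_cube (face (top_singular_cubes R _) i a u).
Proof.
apply/continuousEP => p; apply: funext => j; rewrite /= /mkcts /cone_fun /= /mkcts.
congr (toward_half _ (u _ j)).
  rewrite -[p in LHS]insert_coord0 insert_coordC // (_ : widen_ord _ _ = ord0).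
    by rewrite insert_coord_eq.
  exact: val_inj.
apply: funext => l.
rewrite -[p in LHS]insert_coord0 insert_coordC // (_ : widen_ord _ _ = ord0).
  by rewrite insert_coord_lift.
exact: val_inj.
Qed.

Lemma cone_degenerate m k (u : top_cubes R (solid_cube R m) k) :
  degenerate (top_cubes R _) u -> degenerate (top_cubes R _) (cone_cube u).
Proof.
move=> [i ui]; exists (lift ord0 i) => p q pq; apply: funext => j.
rewrite /= /mkcts /cone_fun /= pq ?neq_lift //; congr (toward_half _ (_ j)).
by apply: ui => l li; apply: pq; rewrite (inj_eq (@lift_inj _ _)).
Qed.

Lemma cone_face_degenerate m k (u : top_cube R (solid_cube R m) k.+1) :
  degenerate (top_cubes R _) (face (top_singular_cubes R _) ord0 false (cone_cube u)).
Proof.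
exists ord0 => p q _; apply: funext => j.
rewrite /= /mkcts /cone_fun /= !insert_coord_eq; exact: toward_half0.
Qed.

End Contraction.

(** * Subdivision and its homotopy to the projection onto normalized chains *)

Section Subdivision.
Variable R : realType.
Local Notation cube m := (solid_cube R m).
Local Notation Q Y n := (free_complex (top_singular_cubes R Y) n).
Local Notation N Y n := (normalized_complex (top_cubes R Y) n).
Local Notation push h n := (normalized_map (top_push R h) n).

Definition cube_class Y n (u : top_cube R Y n) : N Y n :=
  normalization (top_cubes R Y) n << u >>.

Lemma push_class (Y Z : topologicalType) (h : continuousType Y Z) n (u : top_cube R Y n) :
  push h n (cube_class u) = cube_class (top_push_cube h u).
Proof. by rewrite /cube_class normalized_mapE /= free_mapU. Qed.

Lemma class_degenerate Y n (u : top_cube R Y n) :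
  degenerate (top_cubes R Y) u -> cube_class u = 0.
Proof. exact: normalization_degenerate. Qed.

Lemma bd_class Y n (u : top_cube R Y n.+1) :
  bd (normalized_complex (top_cubes R Y)) (cube_class u) =
  \sum_(i < n.+1) (cube_class (top_face i false u) -
                   cube_class (top_face i true u)) *~ (-1) ^+ i.+1.
Proof.
rewrite /cube_class -chain_map_bd free_chain_bdU.
exact: (raddf_cube_boundary (normalization (top_cubes R Y) n)).
Qed.

Definition cone m k : {additive N (cube m) k -> N (cube m) k.+1} :=
  nlift (fun u du => class_degenerate (cone_degenerate (u := u) du)).

Lemma cone_class m k (u : top_cube R (cube m) k) :
  cone m k (cube_class u) = cube_class (cone_cube u).
Proof. exact: nliftU. Qed.

(* The apex of the cone does not contribute in positive degree, because constant cubes are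
   degenerate there. *)
Lemma bd_cone m k (c : N (cube m) k.+1) :
  bd (normalized_complex (top_cubes R (cube m))) (cone m k.+1 c) =
  c - cone m k (bd (normalized_complex (top_cubes R (cube m))) c).
Proof.
apply/eqP; rewrite eq_sym subr_eq eq_sym; apply/eqP.
set d := bd _ (n := k.+1); set d' := bd _ (n := k).
apply: (normalized_complex_ext
  (F := (d \o cone m k.+1) \+ (cone m k \o d')) (G := idfun)) => u.
change (d (cone m k.+1 (cube_class u)) + cone m k (d' (cube_class u)) = cube_class u).
rewrite cone_class !bd_class big_ord_recl.
rewrite [cube_class (top_face ord0 false _)]class_degenerate; last first.
  exact: cone_face_degenerate.
rewrite expr1 mulrN1z opprB subr0 [top_face ord0 true _]cone_face0.
rewrite -addrA; apply/eqP; rewrite -subr_eq0 addrAC subrr add0r; apply/eqP.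
rewrite raddf_sum -big_split big1 // => i _.
(* In the cone, direction i becomes i + 1, which flips the sign: the remaining faces cancel the
   coned faces of u one by one. *)
rewrite raddfMz raddfB !cone_class exprS mulN1r mulrNz.
have ft a : top_face (lift ord0 i) a (cone_cube u) = cone_cube (top_face i a u).
  exact: cone_face_lift.
by rewrite !ft /= addNr.
Qed.

Lemma identity_continuous m : continuous (idfun : cube m -> cube m).
Proof. by move=> x; exact: cvg_id. Qed.

(** The universal m-cube: each u is its image under u ([top_push_identity]). *)
Definition identity_cube m : top_cube R (cube m) m := mkcts (@identity_continuous m).

Lemma top_push_identity Y m (u : top_cube R Y m) :
  top_push_cube u (identity_cube m) = u.
Proof. exact/continuousEP. Qed.

Lemma push_comp (X Y Z : topologicalType) (g : continuousType Y Z)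
    (h : continuousType X Y) (gh : continuousType X Z) n (c : N X n) :
  gh =1 g \o h -> push gh n c = push g n (push h n c).
Proof.
move=> ghE.
apply: (normalized_complex_ext (F := push gh n) (G := push g n \o push h n)) => u.
change (push gh n (cube_class u) = push g n (push h n (cube_class u))).
by rewrite !push_class; congr cube_class; apply/continuousEP => p; exact: ghE.
Qed.

Lemma push_identity m n (c : N (cube m) n) : push (identity_cube m) n c = c.
Proof.
apply: (normalized_complex_ext (F := push (identity_cube m) n) (G := idfun)) => u.
change (push (identity_cube m) n (cube_class u) = cube_class u).
by rewrite push_class; congr cube_class; apply/continuousEP.
Qed.

(** The value on the boundary of the universal (m+1)-cube of the natural operator defined by c (see
    [natural_chain_boundary]). *)
Definition boundary_push m k (c : N (cube m) k) : N (cube m.+1) k :=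
  \sum_(i < m.+1) (push (insert_endpoint R i false) k c -
                   push (insert_endpoint R i true) k c) *~ (-1) ^+ i.+1.

Fixpoint subdivision m : N (cube m) m :=
  if m is k.+1 then cone k.+1 k (boundary_push (subdivision k))
  else cube_class (identity_cube 0).

(** By [bd_cone], the boundary of this cone is the coned chain minus the cone over its boundary. The
    latter is [subdivision], which is why no subdivision term is coned. *)
Fixpoint subdivision_homotopy m : N (cube m) m.+1 :=
  if m is k.+1 then
    cone k.+1 k.+1 (cube_class (identity_cube k.+1) -
                    boundary_push (subdivision_homotopy k))
  else 0.

Lemma subdivisionS m :
  subdivision m.+1 = cone m.+1 m (boundary_push (subdivision m)).
Proof. by []. Qed.

Lemma subdivision_homotopyS m :
  subdivision_homotopy m.+1 = cone m.+1 m.+1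
    (cube_class (identity_cube m.+1) - boundary_push (subdivision_homotopy m)).
Proof. by []. Qed.

Section NaturalChains.
Variables (k : nat -> nat) (c : forall m, N (cube m) (k m)).

(** A chain c m on each universal cube determines a natural operator. Its source is the unnormalized
    complex, so it extends freely from the cubes. *)
Definition natural_chain (Y : topologicalType) m : {additive Q Y m -> N Y (k m)} :=
  zlift (fun u : top_cube R Y m => push u (k m) (c m)).

Lemma natural_chainU (Y : topologicalType) m (u : top_cube R Y m) :
  natural_chain Y m << u >> = push u (k m) (c m).
Proof. exact: zliftU. Qed.

Lemma natural_chain_push (Y Z : topologicalType) (h : continuousType Y Z) m z :
  natural_chain Z m (free_chain_map (top_push R h) m z) =
  push h (k m) (natural_chain Y m z).
Proof.
apply: (free_lift_ext
  (f := natural_chain Z m \o free_chain_map (top_push R h) m)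
  (g := push h (k m) \o natural_chain Y m)) => u.
rewrite /= free_mapU !zliftU; exact: push_comp.
Qed.

Lemma natural_chain_boundary m :
  natural_chain (cube m.+1) m (cube_boundary (X := top_singular_cubes R _)
     (identity_cube m.+1)) = boundary_push (c m).
Proof.
rewrite (raddf_cube_boundary (natural_chain (cube m.+1) m)).
apply: eq_bigr => i _; rewrite !natural_chainU.
have fE a : face (top_singular_cubes R (cube m.+1)) i a (identity_cube m.+1) =
    insert_endpoint R i a by exact/continuousEP.
by rewrite !fE.
Qed.

End NaturalChains.

Local Notation sd := (natural_chain (k := idfun) subdivision).
Local Notation htpy := (natural_chain (k := S) subdivision_homotopy).
Local Notation bdN Y := (bd (normalized_complex (top_cubes R Y))).
Local Notation bdQ Y := (bd (free_complex (top_singular_cubes R Y))).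
Local Notation cls Y n := (normalization (top_cubes R Y) n).

(** Acyclic models: the formula is proved for the universal cube, whose boundary is a cycle to which
    the hypothesis applies. Stated for cycles, the hypothesis also makes sense for m = 0, where
    there is no boundary term. *)
Lemma homotopy_succ m :
  (forall (Y : topologicalType) (z : Q Y m), is_cycle (C := free_complex _) z ->
     cls Y m z = sd Y m z + bdN Y (htpy Y m z)) ->
  forall (Y : topologicalType) (z : Q Y m.+1),
    cls Y m.+1 z = sd Y m.+1 z + bdN Y (htpy Y m.+1 z) + htpy Y m (bdQ Y z).
Proof.
move=> IH Y z.
apply: (free_lift_ext (f := cls Y m.+1)
  (g := (sd Y m.+1 \+ (bdN Y \o htpy Y m.+1)) \+ (htpy Y m \o bdQ Y))) => u.
change (cube_class u =
  sd Y m.+1 << u >> + bdN Y (htpy Y m.+1 << u >>) + htpy Y m (bdQ Y << u >>)).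
pose i := identity_cube m.+1.
have cyc : is_cycle (C := free_complex (top_singular_cubes R (cube m.+1)))
    (bdQ _ << i >>).
  by case: (m) @i => // k i; apply/eqP; exact: bd_bd.
have universal : cube_class i =
    sd _ m.+1 << i >> + bdN _ (htpy _ m.+1 << i >>) + htpy _ m (bdQ _ << i >>).
  have := IH _ _ cyc; rewrite !natural_chainU !push_identity free_chain_bdU.
  rewrite !natural_chain_boundary => bE.
  have bi : bdN _ (cube_class i) = cls _ m (bdQ _ << i >>).
    by rewrite /cube_class chain_map_bd.
  rewrite subdivision_homotopyS bd_cone.
  rewrite [bdN _ (_ - _)]raddfB bi.
  rewrite free_chain_bdU bE addrK subdivisionS.
  by rewrite [X in X + _]addrC subrK subrK.
(* Naturality carries the formula from the universal cube to u. *)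
have uE : << u >> = free_chain_map (top_push R u) m.+1 << i >> :> Q Y m.+1.
  by rewrite /= free_mapU; congr << _ >>; symmetry; exact: top_push_identity.
rewrite uE -chain_map_bd !natural_chain_push -chain_map_bd -!raddfD -universal.
by rewrite push_class top_push_identity.
Qed.

Lemma cycle_homotopy m (Y : topologicalType) (z : Q Y m) :
  is_cycle (C := free_complex _) z ->
  cls Y m z = sd Y m z + bdN Y (htpy Y m z).
Proof.
elim: m Y z => [|m IH] Y z cz.
  apply: (free_lift_ext (f := cls Y 0) (g := sd Y 0 \+ (bdN Y \o htpy Y 0))) => u.
  change (cube_class u = sd Y 0 << u >> + bdN Y (htpy Y 0 << u >>)).
  rewrite !natural_chainU.
  change (cube_class u = push u 0%N (cube_class (identity_cube 0)) + bdN Y (push u 1%N 0)).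
  by rewrite !raddf0 addr0 push_class top_push_identity.
rewrite (homotopy_succ IH); move/eqP: cz => ->.
by rewrite raddf0 addr0.
Qed.

Lemma homotopy m (Y : topologicalType) (z : Q Y m.+1) :
  cls Y m.+1 z = sd Y m.+1 z + bdN Y (htpy Y m.+1 z) + htpy Y m (bdQ Y z).
Proof. by apply: homotopy_succ; exact: cycle_homotopy. Qed.

(** Take the boundary of [homotopy] and compare with [cycle_homotopy] for the boundary of z: both
    contain the same homotopy term, which cancels. *)
Lemma subdivision_bd m (Y : topologicalType) (z : Q Y m.+1) :
  bdN Y (sd Y m.+1 z) = sd Y m (bdQ Y z).
Proof.
have bz : is_cycle (C := free_complex _) (bdQ Y z).
  by case: m z => // m z; apply/eqP; exact: bd_bd.
have := cycle_homotopy bz; rewrite chain_map_bd homotopy !raddfD bd_bd addr0.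
exact: addIr.
Qed.

(** * Action of the cube symmetries on the subdivision *)

Lemma reverse_continuous (T : topologicalType) (f : T -> unit_interval R) :
  continuous f -> continuous (fun x => reverse (f x)).
Proof.
move=> fc; apply: continuous_unit_interval => x.
have fv : {for x, continuous (fun x => set_val (f x) : R)}.
  by apply: continuous_comp; [exact: fc|exact: set_val_continuous].
have rv : {for x, continuous (fun x => 1 - set_val (f x) : R)}.
  by apply: cvgB => //; exact: cvg_cst.
exact: rv.
Qed.

Lemma symmetry_continuous m (s : {perm 'I_m}) b :
  continuous (cube_symmetry (@reverse R) s b : cube m -> cube m).
Proof.
apply: continuous_solid_cube => j; rewrite /cube_symmetry.
have pc := @proj_continuous _ (fun _ : 'I_m => unit_interval R) (s j).
case: (b j); last exact: pc.
exact: reverse_continuous.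
Qed.

Definition symmetry_cube m (s : {perm 'I_m}) b : continuousType (cube m) (cube m) :=
  mkcts (@symmetry_continuous m s b).

(** A symmetry is affine and fixes the centre of the cube, the apex of the cone. *)
Lemma cone_symmetry m k (s : {perm 'I_m}) b (c : N (cube m) k) :
  push (symmetry_cube s b) k.+1 (cone m k c) =
  cone m k (push (symmetry_cube s b) k c).
Proof.
pose g := symmetry_cube s b.
apply: (normalized_complex_ext (F := push g k.+1 \o cone m k)
  (G := cone m k \o push g k)) => u.
change (push g k.+1 (cone m k (cube_class u)) = cone m k (push g k (cube_class u))).
rewrite cone_class !push_class cone_class; congr cube_class.
apply/continuousEP => p; apply: funext => j.
rewrite /= /mkcts /cone_fun /= /mkcts /cube_symmetry /=.
by case: (b j); rewrite // toward_half_reverse.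
Qed.

Lemma lift_perm_surj m (s : {perm 'I_m.+1}) j :
  exists t, s = lift_perm j (s j) t.
Proof.
have sP k : {l | s (lift j k) = lift (s j) l}.
  have [l ->|/perm_inj/eqP] := unliftP (s j) (s (lift j k)); first by exists l.
  by rewrite eq_sym (negbTE (neq_lift _ _)).
have t_inj : injective (fun k => sval (sP k)).
  move=> k l /(congr1 (lift (s j))).
  by rewrite -!(svalP (sP _)) => /perm_inj/lift_inj.
exists (perm t_inj); apply/permP => k; have [l ->|->] := unliftP j k.
  by rewrite lift_perm_lift permE -(svalP (sP l)).
by rewrite lift_perm_id.
Qed.

(* The exponent is the parity of the symmetry: a transposition of coordinates and the
   reversal of one coordinate both reverse the orientation. *)
Lemma subdivision_symmetry m (s : {perm 'I_m}) (b : 'I_m -> bool) :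
  push (symmetry_cube s b) m (subdivision m) =
  subdivision m *~ (-1) ^+ (s + \sum_i b i)%N.
Proof.
elim: m s b => [|m IH] s b.
  rewrite big_ord0 (_ : s = 1%g) ?odd_perm1; last by apply/permP => -[].
  rewrite [subdivision 0]/= push_class; congr cube_class.
  by apply/continuousEP => p; apply: funext => -[].
rewrite subdivisionS cone_symmetry -(raddfMz (cone m.+1 m)); congr (cone m.+1 m _).
rewrite /boundary_push raddf_sum mulrz_suml (reindex_inj (@perm_inj _ s)).
apply: eq_bigr => j _; have [t st] := lift_perm_surj s j.
pose x a := push (insert_endpoint R j a) m (subdivision m).
(* The symmetry carries the face a of direction [s j] to the face [b j (+) a] of direction j, acting
   on it by the symmetry induced by t and the remaining reversals. *)
have pE a : push (symmetry_cube s b) m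
    (push (insert_endpoint R (s j) a) m (subdivision m)) =
    x (b j (+) a) *~ (-1) ^+ (t + \sum_k b (lift j k))%N.
  rewrite /x -raddfMz -IH.
  rewrite -(push_comp
    (gh := top_push_cube (symmetry_cube s b) (insert_endpoint R (s j) a))) //.
  apply: push_comp => p; apply: funext => l; rewrite /= /mkcts /cube_symmetry.
  have [l' ->|->] := unliftP j l.
    have -> : s (lift j l') = lift (s j) (t l') by rewrite {1}st lift_perm_lift.
    by rewrite !insert_coord_lift.
  rewrite !insert_coord_eq; case: (b j) => //=.
  apply: unit_interval_inj; rewrite set_val_reverse !set_val_endpoint.
  by case: a => /=; rewrite ?subrr ?subr0.
rewrite raddfMz raddfB !pE -/(x false) -/(x true) addbF addbT.
have -> : x (b j) *~ (-1) ^+ (t + \sum_k b (lift j k))%N -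
    x (~~ b j) *~ (-1) ^+ (t + \sum_k b (lift j k))%N =
    (x false - x true) *~ (-1) ^+ (b j + (t + \sum_k b (lift j k)))%N.
  rewrite -mulrzBl; case: (b j); last by rewrite add0n.
  by rewrite add1n exprS mulN1r mulrNz -mulNrz opprB.
(* The signs of directions j and [s j] account for the difference between the parities of s and t,
   by [odd_lift_perm]. *)
rewrite -!mulrzA -!exprD; congr (_ *~ _); rewrite -signr_odd -[RHS]signr_odd.
congr (_ ^+ _); rewrite (bigD1_ord j) //= [in RHS]st odd_lift_perm.
rewrite !oddD !oddS !oddb; congr nat_of_bool.
by case: (b j); case: (odd j); case: (odd (s j)); case: (odd_perm t); case: (odd _).
Qed.
End Subdivision.

(** * Automorphisms of the discrete cube *)

Section Flip.
Variable n : nat.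
Implicit Types (v w : hypercube n) (i j k : 'I_n).

Definition flip k v : hypercube n := fun i => v i (+) (i == k).

Lemma flipE k v i : flip k v i = v i (+) (i == k). Proof. by []. Qed.

Lemma flipK k : involutive (flip k).
Proof. by move=> v; apply: funext => i; rewrite /flip -addbA addbb addbF. Qed.

Lemma flip_injl v k l : flip k v = flip l v -> k = l.
Proof.
move=> /(congr1 (@^~ k)); rewrite /flip eqxx => /addbI/esym/eqP; exact.
Qed.

Lemma flip_adj k v : adj v (flip k v).
Proof.
exists k; split=> [|j]; rewrite /flip; first by rewrite eqxx; case: (v k).
by case: (j =P k) => [->|]; rewrite ?addbF.
Qed.

Lemma adj_flip v w : adj v w -> exists k, w = flip k v.
Proof.
move=> [k [vwk uk]]; exists k; apply: funext => i; rewrite /flip.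
have [->|/eqP ik] := eqVneq; first by move: vwk; case: (v k); case: (w k).
by rewrite addbF; apply: contrapT => wv; apply: ik; rewrite (uk i) // => /esym.
Qed.

Lemma flip_invariant (T : Type) (f : hypercube n -> T) :
  (forall k v, f (flip k v) = f v) -> forall v w, f v = f w.
Proof.
(* [u m] takes its first m coordinates from w and the others from v: a path from v to w whose steps
   are trivial or flips. *)
move=> fP v w; pose u m : hypercube n := fun i => if (i < m)%N then w i else v i.
have uP m : f (u m) = f v.
  elim: m => [|m <-]; first by congr f; apply: funext => i; rewrite /u ltn0.
  have [mn|nm] := ltnP m n; last first.
    congr f; apply: funext => i; rewrite /u.
    by rewrite !(leq_trans (ltn_ord i)) // ltnW.
  have [vw|vw] := eqVneq (v (Ordinal mn)) (w (Ordinal mn)).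
    congr f; apply: funext => i; rewrite /u ltnS leq_eqVlt.
    case: (i =P m :> nat) => [im|//]; rewrite im ltnn /=.
    by rewrite (_ : i = Ordinal mn) //; apply: val_inj.
  rewrite -(fP (Ordinal mn)); congr f; apply: funext => i; rewrite /u /flip.
  rewrite ltnS leq_eqVlt -val_eqE /=.
  case: (i =P m :> nat) => [im|_]; last by rewrite addbF.
  rewrite im ltnn /= (_ : i = Ordinal mn); last exact: val_inj.
  by move: vw; case: (v _); case: (w _).
rewrite -(uP n); congr f; apply: funext => i; by rewrite /u ltn_ord.
Qed.

Lemma cube_symmetry_addb (s : {perm 'I_n}) (b : 'I_n -> bool) v i :
  cube_symmetry negb s b v i = v (s i) (+) b i.
Proof. by rewrite /cube_symmetry; case: (b i); rewrite ?addbT ?addbF. Qed.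

End Flip.

Lemma injective_adj (G H : graph) (f : graph_map G H) u v :
  injective f -> adj u v -> adj (f u) (f v).
Proof.
move=> f_inj uv; case: (graph_fun_adj f uv) => // /f_inj uvE.
by case: (@adj_irrefl G v); rewrite -{1}uvE.
Qed.

(** Let [d (k, v)] be the direction of the image of the edge at v in direction k. It does not depend
    on v, so it defines a permutation of the directions; the image of the origin gives the
    reversals. *)
Lemma hypercube_automorphism n (f : graph_map (hypercube n) (hypercube n)) :
  injective f -> exists s b, f = symmetry_graph_map s b.
Proof.
move=> f_inj.
have /choice[d dP] : forall kv : 'I_n * hypercube n,
    exists m, f (flip kv.1 kv.2) = flip m (f kv.2).
  by move=> kv; exact/adj_flip/(injective_adj f_inj)/flip_adj.
have {}dP k v : f (flip k v) = flip (d (k, v)) (f v) by exact: (dP (k, v)).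
have dl l k v : d (k, flip l v) = d (k, v).
  have [->|lk] := eqVneq l k.
    have := dP k (flip k v); rewrite flipK dP => /(congr1 (flip (d (k, flip k v)))).
    by rewrite flipK => e; exact: flip_injl e.
  have klC : flip k (flip l v) = flip l (flip k v).
    by apply: funext => i; rewrite /flip addbAC.
  have bd : d (l, v) != d (k, v).
    apply: contraNneq lk => e; apply/eqP/(@flip_injl _ v); apply: f_inj.
    by rewrite !dP e.
  (* The two paths around a square end at the same vertex. In coordinate [d (k, v)] this leaves
     either the claim or a path folding back to [f v], against injectivity. *)
  have : f (flip k (flip l v)) = f (flip l (flip k v)) by rewrite klC.
  rewrite dP (dP l v) (dP l (flip k v)) (dP k v) => e.
  have := congr1 (@^~ (d (k, v))) e; rewrite /= !flipE -!addbA => /addbI.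
  rewrite eqxx [_ == d (l, v)]eq_sym (negbTE bd) addFb.
  case: eqVneq => [//|_]; case: eqVneq => [ec _|//].
  move: e; rewrite -ec flipK -dP -dP => /f_inj/(congr1 (flip k)).
  by rewrite flipK => /flip_injl/eqP; rewrite (negbTE lk).
have dc k v : d (k, v) = d (k, fun=> false).
  by apply: (@flip_invariant n _ (fun v => d (k, v))) => l w; exact: dl.
pose e k := d (k, fun=> false).
have e_inj : injective e.
  move=> k l kl; apply: (@flip_injl _ (fun=> false)); apply: f_inj.
  by rewrite !dP -/(e k) kl.
exists (perm e_inj)^-1%g, (f (fun=> false)); apply: graph_map_ext => v.
apply: funext => i; rewrite /= cube_symmetry_addb.
pose s := (perm e_inj)^-1%g.
(* Flipping k changes [f v i] and [v (s i)] in the same case, i = [e k], so their sum is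
   constant. *)
have : f v i (+) v (s i) = f (fun=> false) i (+) false.
  apply: (@flip_invariant n _ (fun v => f v i (+) v (s i))) => k w.
  rewrite dP dc -/(e k) /flip.
  have -> : (s i == k) = (i == e k).
    by rewrite -(inj_eq (@perm_inj _ (perm e_inj))) permKV permE.
  by rewrite addbACA addbb addbF.
by rewrite addbF => <-; rewrite -/s addbCA addbb addbF.
Qed.

(** * Cubes with the same image *)

Lemma subgraph_ext (G : graph) (P Q : subgraph G) :
  sub_vertex P = sub_vertex Q ->
  (forall u v, sub_edge P u v <-> sub_edge Q u v) -> P = Q.
Proof.
case: P => PV PE Pa Ps Pv; case: Q => QV QE Qa Qs Qv /= VE EE.
have {}EE : PE = QE by apply: funext => u; apply: funext => v; apply: propext.
case: _ / VE in Qv *; case: _ / EE in Qa Qs Qv *.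
by congr Subgraph; exact: Prop_irrelevance.
Qed.

(** The right inverse f' makes f surjective on vertices and on edges. *)
Lemma image_graph_comp (G H K : graph) (g : graph_map H K) (f : graph_map G H)
    (f' : graph_map H G) :
  cancel f' f -> image_graph (graph_comp g f) = image_graph g.
Proof.
move=> f'K; apply: subgraph_ext => [|u v].
  rewrite eqEsubset; split=> _ [w _ <-]; first by exists (f w).
  by exists (f' w); rewrite //= f'K.
split=> -[uv [a [b [ab au bv]]]]; split=> //.
  have [fab|fab] := graph_fun_adj f ab; last by exists (f a), (f b).
  case: (@adj_irrefl K u); suff {2}-> : u = v by [].
  by rewrite -au -bv /= fab.
have [fab|fab] := graph_fun_adj f' ab; last by exists (f' a), (f' b); rewrite /= !f'K.
by case: (@adj_irrefl H a); rewrite -{2}(f'K a) fab f'K.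
Qed.

Lemma cube_symmetryK n (s : {perm 'I_n}) (b : 'I_n -> bool) :
  cancel (symmetry_graph_map s^-1%g (b \o s^-1%g)) (symmetry_graph_map s b).
Proof.
move=> v; apply: funext => i; rewrite /= !cube_symmetry_addb /= permK.
by rewrite -addbA addbb addbF.
Qed.

Lemma image_graph_symmetry (G : graph) n (u : singular_cube G n) s b :
  image_graph (graph_comp u (symmetry_graph_map s b)) = image_graph u.
Proof. exact: image_graph_comp (@cube_symmetryK n s b). Qed.

Section SameImage.
Variables (G : graph) (n : nat) (u v : singular_cube G n).
Hypotheses (u_inj : injective u) (uv : image_graph v = image_graph u).

Lemma same_image_lift : exists f : hypercube n -> hypercube n, forall p, u (f p) = v p.
Proof.
suff /choice[f fP] : forall p, exists q, u q = v p by exists f.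
move=> p; have : sub_vertex (image_graph u) (v p) by rewrite -uv; exists p.
by case=> q _; exists q.
Qed.

Lemma same_image_injective : injective v.
Proof.
have [f fP] := same_image_lift.
have [g gP] : exists g : hypercube n -> hypercube n, forall p, v (g p) = u p.
  suff /choice[g gP] : forall p, exists q, v q = u p by exists g.
  move=> p; have : sub_vertex (image_graph v) (u p) by rewrite uv; exists p.
  by case=> q _; exists q.
have fgK p : f (g p) = p by apply: u_inj; rewrite fP gP.
(* Vertices are recoded as finite functions, so that injectivity of g on a finite type yields
   bijectivity. *)
pose g' (p : {ffun 'I_n -> bool}) : {ffun 'I_n -> bool} := [ffun i => g p i].
have g'_inj : injective g'.
  move=> p q /ffunP pq; apply/ffunP => i.
  rewrite -[fun_of_fin p]fgK -[fun_of_fin q in RHS]fgK; congr (f _ i).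
  by apply: funext => j; have := pq j; rewrite !ffunE.
have [h g'K hK] := injF_bij g'_inj.
move=> p q vpq; have gh (r : hypercube n) : g (h [ffun i => r i]) = r.
  apply: funext => i; have /ffunP/(_ i) := hK [ffun i => r i].
  by rewrite !ffunE.
rewrite -(gh p) -(gh q) in vpq *; congr g.
by move: vpq; rewrite !gP => /u_inj.
Qed.

(** The lift f of v through u is injective, and it preserves adjacency because the edges of v are
    edges of the image of u; hence it is a symmetry. *)
Lemma same_image_symmetry : exists s b, v = graph_comp u (symmetry_graph_map s b).
Proof.
have [f fP] := same_image_lift.
have f_adj p q : adj p q -> f p = f q \/ adj (f p) (f q).
  move=> pq; right; have : sub_edge (image_graph u) (v p) (v q).
    rewrite -uv; split; last by exists p, q.
    exact: (injective_adj same_image_injective).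
  by case=> _ [p' [q' [pq']]]; rewrite -!fP => /u_inj <- /u_inj <-.
have [p q /= fpq|s [b fE]] := @hypercube_automorphism n (GraphMap f_adj).
  by apply: same_image_injective; rewrite -!fP fpq.
exists s, b; apply: graph_map_ext => p; rewrite -fP.
by congr (u _); have -> : f p = GraphMap f_adj p by []; rewrite fE.
Qed.

End SameImage.

Lemma image_is_cube (G : graph) n (u : singular_cube G n) :
  injective u -> is_cube n (image_graph u).
Proof.
move=> u_inj; exists u; split=> // p q.
split=> [pq|[_ [p' [q' [pq' /u_inj <- /u_inj <-]]]] //].
by split; [exact: injective_adj|exists p, q].
Qed.

(** Three shapes survive: the identity, a single reversal (second alternative), and a transposition
    with exactly one of its two coordinates reversed, a quarter turn, which is even. *)
Lemma near_identity_symmetry n (s : {perm 'I_n}) (b : 'I_n -> bool) :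
  (forall p, cube_symmetry negb s b p = p \/
     exists k, cube_symmetry negb s b p = flip k p) ->
  ~~ odd (s + \sum_i b i) \/ exists k, cube_symmetry negb s b =1 flip k.
Proof.
move=> near_id.
(* No vertex moves in two coordinates. Every other shape of (s, b) is refuted below by a vertex p
   chosen to move in two. *)
have one p i j : p (s i) (+) b i != p i -> p (s j) (+) b j != p j -> i = j.
  rewrite -!cube_symmetry_addb; case: (near_id p) => [->|[k ->]].
    by rewrite eqxx.
  have flip_neq l : (flip k p l != p l) = (l == k).
    by rewrite flipE; case: (p l); case: (l == k).
  by rewrite !flip_neq => /eqP -> /eqP ->.
have [s1|] := pselect (forall i, s i = i).
  have [b0|/existsNP [k /negP/negPn bk]] := pselect (forall i, ~~ b i).
    left; rewrite big1 => [|i _]; last by rewrite (negbTE (b0 i)).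
    by rewrite (_ : s = 1%g) ?odd_perm1 //; apply/permP => i; rewrite perm1.
  right; exists k => p; apply: funext => i.
  rewrite cube_symmetry_addb s1 flipE; congr (_ (+) _).
  have [->|ik] := eqVneq i k; first exact: bk.
  apply/negP => bi; move: ik; rewrite (one (fun=> false) i k) ?eqxx //.
    by rewrite bi.
  by rewrite bk.
move=> /existsNP[i /eqP si].
set k := s i in si.
have sk : s k = i.
  apply/eqP; apply: contraT => ski.
  have skk : s k != k by rewrite (inj_eq (@perm_inj _ s)).
  pose p x := if x == i then ~~ b i else if x == s k then ~~ b k else false.
  suff /eqP : i = k by rewrite eq_sym (negbTE si).
  apply: (one p); rewrite -?/k /p eqxx.
    by rewrite (negbTE si) [k == _]eq_sym (negbTE skk); case: (b i).
  rewrite (negbTE ski) (negbTE si) [k == _]eq_sym (negbTE skk).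
  by case: (b k).
have fixed l : l != i -> l != k -> s l = l /\ ~~ b l.
  move=> li lk.
  have sli : s l != i by rewrite -sk (inj_eq (@perm_inj _ s)).
  have slk : s l != k by rewrite /k (inj_eq (@perm_inj _ s)).
  have [sl|sl] := eqVneq (s l) l; [split=> //; apply/negP => bl|exfalso].
  - pose p x := if x == i then ~~ b i else false.
    suff /eqP : i = l by rewrite eq_sym (negbTE li).
    apply: (one p); rewrite -?/k /p ?eqxx.
      by rewrite (negbTE si); case: (b i).
    by rewrite sl (negbTE li) bl.
  - pose p x := if x == i then ~~ b i else if x == s l then ~~ b l else false.
    suff /eqP : i = l by rewrite eq_sym (negbTE li).
    apply: (one p); rewrite -?/k /p ?eqxx.
      by rewrite (negbTE si) [k == _]eq_sym (negbTE slk); case: (b i).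
    by rewrite (negbTE sli) (negbTE li) [l == _]eq_sym (negbTE sl); case: (b l).
have bik : b k = ~~ b i.
  apply/eqP; apply: contraT => bik.
  pose p x := if x == i then ~~ b i else false.
  suff /eqP : i = k by rewrite eq_sym (negbTE si).
  apply: (one p); rewrite -?/k ?sk /p ?eqxx.
    by rewrite (negbTE si); case: (b i).
  by rewrite (negbTE si); move: bik; case: (b i); case: (b k).
have sE : s = tperm i k.
  apply/permP => l; case: tpermP => [->|->|/eqP li /eqP lk] //.
  by case: (fixed l li lk).
left; rewrite sE odd_tperm eq_sym si /= (bigD1 i) //= (bigD1 k) //=.
rewrite big1 => [|l /andP[li lk]].
  by rewrite bik; case: (b i).
by case: (fixed l li lk) => _ /negbTE ->.
Qed.

(** * Noninjective singular cubes *)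

(** i' and j' are the indices of i and j once the other is deleted. Only the larger index drops, by
    one, whence the change of parity. *)
Lemma lift_pair m (i j : 'I_m.+2) : i != j ->
  exists i' j' : 'I_m.+1, [/\ j = lift i j', i = lift j i',
    odd (i' + j') = ~~ odd (i + j) &
    forall l, lift i (lift j' l) = lift j (lift i' l)].
Proof.
move=> ij; have [j' jE|jE] := unliftP i j; last by rewrite jE eqxx in ij.
have [i' iE|iE] := unliftP j i; last by rewrite iE eqxx in ij.
have := congr1 val jE; have := congr1 val iE; rewrite /= /bump => iN jN.
exists i', j'; split=> // [|l]; first by move: iN jN; do 2 case: leqP => /=; lia.
by apply: val_inj; rewrite /= /bump; move: iN jN; do 6 case: leqP => /=; lia.
Qed.

Lemma flip_insert n (i : 'I_n.+1) a (p : hypercube n) :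
  flip i (insert_coord i a p) = insert_coord i (~~ a) p.
Proof.
apply: funext => j; rewrite flipE; have [k ->|->] := unliftP i j.
  by rewrite !insert_coord_lift [_ == i]eq_sym (negbTE (neq_lift _ _)) addbF.
by rewrite !insert_coord_eq eqxx addbT.
Qed.

Lemma flip_insert_lift n (i : 'I_n.+1) a k (p : hypercube n) :
  flip (lift i k) (insert_coord i a p) = insert_coord i a (flip k p).
Proof.
apply: funext => j; rewrite flipE; have [l ->|->] := unliftP i j.
  by rewrite !insert_coord_lift flipE (inj_eq (@lift_inj _ _)).
by rewrite !insert_coord_eq (negbTE (neq_lift _ _)) addbF.
Qed.

Lemma insert_coord_restrict (T : Type) n (i : 'I_n.+1) (v : 'I_n.+1 -> T) :
  insert_coord i (v i) (v \o lift i) = v.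
Proof.
apply: funext => j; have [k ->|->] := unliftP i j.
  by rewrite insert_coord_lift.
by rewrite insert_coord_eq.
Qed.

Lemma insert_swap (T : Type) m (i j : 'I_m.+2) (i' j' : 'I_m.+1) (a b : T) p :
  j = lift i j' -> i = lift j i' ->
  (forall l, lift i (lift j' l) = lift j (lift i' l)) ->
  insert_coord j b (insert_coord i' a p) = insert_coord i a (insert_coord j' b p).
Proof.
move=> jE iE lE; apply: funext => k; have [k' ->|->] := unliftP j k; last first.
  by rewrite insert_coord_eq [in RHS]jE insert_coord_lift insert_coord_eq.
rewrite insert_coord_lift; have [l ->|->] := unliftP i' k'; last first.
  by rewrite insert_coord_eq -iE insert_coord_eq.
by rewrite insert_coord_lift -lE !insert_coord_lift.
Qed.

(** Both faces restrict to t on the codimension-2 face i = a, j = b. Injectivity makes the symmetry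
    between them the identity there, which determines it: s is [lift_perm j' i' 1] and only j' may
    be reversed. *)
Lemma crossing_faces (G : graph) n (t : singular_cube G n.+1) (i j : 'I_n.+1) a b :
  i != j -> injective (singular_face i a t) ->
  image_graph (singular_face j b t) = image_graph (singular_face i a t) ->
  exists (s : {perm 'I_n}) r,
    [/\ singular_face j b t = graph_comp (singular_face i a t) (symmetry_graph_map s r),
      odd (s + \sum_k r k) = ~~ (odd (i + j) (+) a (+) b) &
      forall v : hypercube n.+1, v i = a -> v j = b -> t (flip i v) = t (flip j v)].
Proof.
case: n t i j => [|m] t i j ij u_inj uw; first by rewrite !ord1 in ij.
have [i' [j' [jE iE ijE lE]]] := lift_pair ij.
have swap e e' (p : hypercube m) : insert_coord j e' (insert_coord i' e p) =
  insert_coord i e (insert_coord j' e' p) by exact: insert_swap.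
have [s [r wE]] := same_image_symmetry u_inj uw.
have wv q : t (insert_coord j b q) = t (insert_coord i a (cube_symmetry negb s r q)).
  by have := congr1 (fun g : singular_cube G m.+1 => g (q : hypercube m.+1)) wE.
have sE p : cube_symmetry negb s r (insert_coord i' a p) = insert_coord j' b p.
  by apply: u_inj; rewrite /= -swap; symmetry; exact: wv.
have srj : s j' = i' /\ r j' = a (+) b.
  have rj p : insert_coord i' a p (s j') (+) r j' = b.
    by rewrite -cube_symmetry_addb sE insert_coord_eq.
  have [k sj|sj] := unliftP i' (s j').
    have := rj (fun=> true); rewrite sj -(rj (fun=> false)) sj !insert_coord_lift.
    by case: (r j').
  split=> //; have := rj (fun=> false); rewrite sj insert_coord_eq => <-.
  by rewrite addbA addbb.
have srl k : s (lift j' k) = lift i' k /\ r (lift j' k) = false.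
  have [l sl|sl] := unliftP i' (s (lift j' k)); last first.
    have := etrans sl (esym srj.1) => /perm_inj/eqP.
    by rewrite eq_sym (negbTE (neq_lift _ _)).
  have rk p : p l (+) r (lift j' k) = p k.
    rewrite -[RHS](insert_coord_lift j' b p k) -sE cube_symmetry_addb sl.
    by rewrite insert_coord_lift.
  have r0 : r (lift j' k) = false by have := rk (fun=> false).
  split=> //; rewrite sl; congr lift; apply/eqP.
  by have := rk (fun x => x == k); rewrite r0 addbF eqxx.
exists s, r; split=> //.
  have -> : s = lift_perm j' i' 1.
    apply/permP => k; have [l ->|->] := unliftP j' k.
      by rewrite lift_perm_lift perm1; case: (srl l).
    by rewrite lift_perm_id; case: srj.
  rewrite odd_lift_perm odd_perm1 (bigD1_ord j') //= big1 => [|k _].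
    rewrite srj.2 addn0 oddD !oddb addbF [odd (i + j)]oddD.
    move: ijE; rewrite !oddD; clear; case: (odd i'); case: (odd j');
      by case: (odd i (+) odd j); case: a; case: b.
  by case: (srl k) => _ ->.
move=> v vi vj; pose p := v \o lift j \o lift i'.
have vE : v = insert_coord j b (insert_coord i' a p).
  rewrite -[v in LHS](insert_coord_restrict j) vj; congr insert_coord.
  by rewrite -[LHS](insert_coord_restrict i') /= -iE vi.
(* [flip i v] lies on the face j = b; the symmetry takes it to [flip j v] on the face i = a. *)
rewrite vE flip_insert {1}iE flip_insert_lift flip_insert wv swap.
congr (t (insert_coord i a _)); apply: funext => k; rewrite cube_symmetry_addb.
have [l ->|->] := unliftP j' k.
  by case: (srl l) => -> ->; rewrite !insert_coord_lift addbF.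
case: srj => -> ->; rewrite !insert_coord_eq.
by case: (a); case: (b).
Qed.

(** Exchange coordinate i with coordinate [lift i k]. Where they differ, the hypothesis identifies
    the point with i = ~~ a, [lift i k] = a and the point with the two values exchanged. *)
Lemma reversed_face (G : graph) n (t : singular_cube G n.+1) (i : 'I_n.+1) a k :
  (forall p, t (insert_coord i (~~ a) p) = t (insert_coord i a (flip k p))) ->
  exists s r, singular_face (lift i k) a t =
    graph_comp (singular_face i a t) (symmetry_graph_map s r).
Proof.
case: n t i k => [|m] t i k tk; first by case: k {tk}.
have [i' [k' [/lift_inj kE iE _ lE]]] := lift_pair (neq_lift i k).
move: lE; rewrite -{}kE => lE.
exists (lift_perm k i' 1), (fun=> false); apply: graph_map_ext => q /=.
rewrite -[q](insert_coord_restrict i'); move: (q i') (q \o lift i') => e p.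
rewrite (insert_swap e a p (erefl _) iE lE).
have -> : cube_symmetry negb (lift_perm k i' 1) (fun=> false) (insert_coord i' e p) =
    insert_coord k e p.
  apply: funext => x; rewrite /cube_symmetry; have [l ->|->] := unliftP k x.
    by rewrite lift_perm_lift perm1 !insert_coord_lift.
  by rewrite lift_perm_id !insert_coord_eq.
have [->//|ea] := eqVneq e a.
by rewrite (_ : e = ~~ a) ?tk ?flip_insert //; move: ea; case: (e); case: (a).
Qed.

Lemma sum_over_classes (T : finType) (V : zmodType) (P : T -> Prop) (e : T -> T -> Prop)
    (F : T -> V) :
  (forall x, P x -> e x x) -> (forall x y, e x y -> e y x) ->
  (forall x y z, e x y -> e y z -> e x z) ->
  (forall x y, e x y -> P y) ->
  (forall x, P x -> \sum_(y | `[< e x y >]) F y = 0) ->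
  \sum_(x | `[< P x >]) F x = 0.
Proof.
move=> exx e_sym e_trans eP eF.
(* The choice depends only on the class of x, so [key] is constant on classes and separates them. *)
pose key x := [pick y | `[< e x y >]].
rewrite (partition_big key predT) //= big1 // => o _.
have [[x [/asboolP Px /eqP kx]]|none] :=
    pselect (exists x, `[< P x >] /\ key x == o); last first.
  by rewrite big_pred0 // => x; apply/negP => /andP[? ?]; apply: none; exists x.
rewrite -[RHS](eF x Px); apply: eq_bigl => y; rewrite -kx.
apply/andP/asboolP => [[/asboolP Py /eqP]|xy].
  rewrite /key; case: pickP => [z /asboolP yz|none _]; last first.
    by have := none y; rewrite asboolT //; exact: exx.
  case: pickP => // z' /asboolP xz' [zz']; rewrite -zz' in xz'.
  exact: e_trans xz' (e_sym _ _ yz).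
split; first exact/asboolP/(eP x).
apply/eqP/eq_pick => z; apply: asbool_equiv_eq; split; first exact: e_trans xy.
exact/e_trans/e_sym.
Qed.

(** * Cancellation among the faces supported by one cube *)

Section NoninjectiveBoundary.
Variables (G : graph) (n : nat) (V : zmodType) (c : singular_cube G n -> V).
Hypothesis c_symmetry : forall (u : singular_cube G n) (s : {perm 'I_n}) b,
  injective u ->
  c (graph_comp u (symmetry_graph_map s b)) = c u *~ (-1) ^+ (s + \sum_i b i)%N.
Variable t : singular_cube G n.+1.

Local Notation tface x := (singular_face x.1 x.2 t).

(** A partial equivalence relation, reflexive exactly on the injective faces; its classes correspond
    to the cubes supporting them. *)
Definition parallel_faces (x y : 'I_n.+1 * bool) : Prop :=
  injective (tface x) /\ image_graph (tface y) = image_graph (tface x).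

Lemma parallel_faces_sym x y : parallel_faces x y -> parallel_faces y x.
Proof. by move=> [xi xy]; split=> //; exact: same_image_injective xi xy. Qed.

Lemma parallel_faces_trans x y z :
  parallel_faces x y -> parallel_faces y z -> parallel_faces x z.
Proof. by move=> [xi xy] [yi yz]; split=> //; rewrite yz. Qed.

(** The face with its sign in the boundary; an upper face has one more minus sign. *)
Definition face_term (x : 'I_n.+1 * bool) : V := c (tface x) *~ (-1) ^+ (x.1.+1 + x.2)%N.

Lemma mulrz_sign (x : V) k l : odd k = odd l -> x *~ (-1) ^+ k = x *~ (-1) ^+ l.
Proof. by move=> kl; rewrite -signr_odd kl signr_odd. Qed.

Lemma mulrz_signN (x : V) k l : odd k = ~~ odd l -> x *~ (-1) ^+ k + x *~ (-1) ^+ l = 0.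
Proof.
move=> kl; rewrite (@mulrz_sign _ k l.+1) // exprS mulN1r mulrNz.
by rewrite addNr.
Qed.

Lemma parallel_faces_cross i j a b : i != j -> parallel_faces (i, a) (j, b) ->
  face_term (i, a) + face_term (j, b) = 0 /\
  forall v : hypercube n.+1, v i = a -> v j = b -> t (flip i v) = t (flip j v).
Proof.
move=> ij [/= u_inj uw].
have [s [r [wE sr flipE]]] := crossing_faces ij u_inj uw; split=> //.
rewrite /face_term /= wE c_symmetry // -mulrzA -exprD; apply: mulrz_signN.
rewrite oddD [odd (s + _ + _)]oddD sr !oddD /= !oddb; clear.
by case: (odd i); case: (odd j); case: a; case: b.
Qed.

(** For v on all three faces, [flip i v] and [flip j v] are distinct vertices of the face k = d with
    the same value under t. *)
Lemma parallel_faces_three i j k a b d : i != j -> k != i -> k != j ->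
  parallel_faces (i, a) (j, b) -> injective (tface (k, d)) -> False.
Proof.
move=> ij ki kj /(parallel_faces_cross ij)[_ tij] u_inj.
pose v : hypercube n.+1 := fun x => if x == i then a else if x == j then b else d.
have vi : v i = a by rewrite /v eqxx.
have vj : v j = b by rewrite /v eq_sym (negbTE ij) eqxx.
have vk : v k = d by rewrite /v (negbTE ki) (negbTE kj).
have fk l : k != l -> flip l v = insert_coord k d (flip l v \o lift k).
  move=> kl; rewrite -[LHS](insert_coord_restrict k) flipE (negbTE kl) addbF.
  by rewrite vk.
have := tij v vi vj; rewrite (fk i) // (fk j) // => /u_inj e.
have : flip i v = flip j v by rewrite (fk i) // (fk j) // e.
by move=> /flip_injl/eqP; rewrite (negbTE ij).
Qed.

(** Crossing (j, b) with both faces in direction i gives t (flip i v) = t (flip j v) on all of j =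
    b. So the face (j, ~~ b) is the face (j, b) reflected in direction i. *)
Lemma parallel_faces_opposite i j a b : i != j ->
  parallel_faces (i, a) (i, ~~ a) -> parallel_faces (i, a) (j, b) ->
  parallel_faces (i, a) (j, ~~ b).
Proof.
move=> ij pa pb; have [_ tij] := parallel_faces_cross ij pb.
have [_ tij'] := parallel_faces_cross ij
  (parallel_faces_trans (parallel_faces_sym pa) pb).
have tj (v : hypercube n.+1) : v j = b -> t (flip i v) = t (flip j v).
  have [/tij|via] := eqVneq (v i) a; first exact.
  by apply: tij'; move: via; case: (v i); case: (a).
have [k iE|iE] := unliftP j i; last by rewrite iE eqxx in ij.
apply: (parallel_faces_trans pb); split; first exact: (parallel_faces_sym pb).1.
rewrite -[RHS](image_graph_symmetry _ 1 (pred1 k)); congr image_graph.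
apply: graph_map_ext => p /=; rewrite -flip_insert -tj ?insert_coord_eq //.
rewrite {1}iE flip_insert_lift; congr (t (insert_coord j b _)); apply: funext => x.
by rewrite cube_symmetry_addb perm1.
Qed.

(** Edges of t in direction i join a vertex to its image under the symmetry between the two faces.
    By rigidity they lie in the supporting cube, so [near_identity_symmetry] applies: an even
    symmetry gives cancellation, a reflection a parallel face in another direction. *)
Lemma parallel_faces_same i a : rigid (image_graph (tface (i, a))) ->
  parallel_faces (i, a) (i, ~~ a) ->
  face_term (i, a) + face_term (i, ~~ a) = 0 \/
  exists j b, j != i /\ parallel_faces (i, a) (j, b).
Proof.
move=> rig pa; have u_inj : injective (tface (i, a)) := pa.1.
have uw : image_graph (tface (i, ~~ a)) = image_graph (tface (i, a)) := pa.2.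
have [s [r wE]] := same_image_symmetry u_inj uw.
have wv q : t (insert_coord i (~~ a) q) = t (insert_coord i a (cube_symmetry negb s r q)).
  by have := congr1 (fun g : singular_cube G n => g (q : hypercube n)) wE.
have near_id p : cube_symmetry negb s r p = p \/
    exists k, cube_symmetry negb s r p = flip k p.
  have := graph_fun_adj t (flip_adj i (insert_coord i a p)).
  rewrite flip_insert wv; case=> [/u_inj <-|tadj]; first by left.
  right; have [] := rig (tface (i, a) p) (tface (i, a) (cube_symmetry negb s r p)).
  - by exists p.
  - by exists (cube_symmetry negb s r p).
  - exact: tadj.
  by move=> _ [p' [q' [pq /u_inj <- /u_inj <-]]]; exact: adj_flip.
have [even|[k kE]] := near_identity_symmetry near_id.
  left; rewrite /face_term /= wE c_symmetry // -mulrzA -exprD; apply: mulrz_signN.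
  rewrite oddD [odd (s + _ + _)]oddD (negbTE even) oddD /= !oddb.
  by case: (a); case: (odd i).
right; exists (lift i k), a; split; first by rewrite eq_sym neq_lift.
split=> //=; have [|s' [r' ->]] := @reversed_face G n t i a k.
  by move=> p; rewrite wv kE.
exact: image_graph_symmetry.
Qed.

Lemma sum_parallel_faces x : rigid (image_graph (tface x)) ->
  injective (tface x) ->
  (exists y, y <> x /\ image_graph (tface y) = image_graph (tface x)) ->
  \sum_(y | `[< parallel_faces x y >]) face_term y = 0.
Proof.
case: x => i a rig u_inj [y [yx yimg]].
have pii : parallel_faces (i, a) (i, a) by [].
have pD1 (T : finType) (z : T) (P : pred T) (F : T -> V) :
    P z -> \sum_(y | P y) F y = F z + \sum_(y | P y && (y != z)) F y.
  by move=> Pz; rewrite (bigD1 z).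
(* If another direction j occurs, no third one does, and the class consists of two or four faces
   that cancel in crossing pairs. *)
have [[j [b [ji pj]]]|none] := pselect (exists j b, j != i /\ parallel_faces (i, a) (j, b)).
  have ij : i != j by rewrite eq_sym.
  have [eqT _] := parallel_faces_cross ij pj.
  have only k d : parallel_faces (i, a) (k, d) -> (k == i) || (k == j).
    move=> pk; apply/norP => -[ki kj].
    apply: (@parallel_faces_three i j k a b d ij ki kj pj).
    exact: (parallel_faces_sym pk).1.
  have neqb (d : bool) : (d == ~~ d) = false by case: d.
  rewrite (pD1 _ (i, a)) ?asboolT // (pD1 _ (j, b)); last first.
    by rewrite asboolT //= xpair_eqE (negbTE ji).
  rewrite addrA eqT add0r.
  have [pia|npia] := pselect (parallel_faces (i, a) (i, ~~ a)).
    have pjb := parallel_faces_opposite ij pia pj.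
    have [eqT' _] := parallel_faces_cross ij
      (parallel_faces_trans (parallel_faces_sym pia) pjb).
    rewrite (pD1 _ (i, ~~ a)); last first.
      by rewrite asboolT //= !xpair_eqE eqxx (negbTE ij) /= eq_sym neqb.
    rewrite (pD1 _ (j, ~~ b)); last first.
      by rewrite asboolT //= !xpair_eqE eqxx (negbTE ji) /= eq_sym neqb.
    rewrite addrA eqT' add0r big_pred0 // => -[k d].
    apply/negP => /andP[/andP[/andP[/andP[/asboolP pk]]]].
    rewrite !xpair_eqE; case/orP: (only _ _ pk) => /eqP ->; rewrite eqxx /=.
      by case: (d); case: (a).
    by case: (d); case: (b).
  rewrite big_pred0 // => -[k d]; apply/negP => /andP[/andP[/asboolP pk]].
  rewrite !xpair_eqE; case/orP: (only _ _ pk) => /eqP kE; rewrite kE in pk *;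
    rewrite eqxx /=.
    by move=> da _; apply: npia; rewrite (_ : ~~ a = d) //; move: da; case: (d); case: (a).
  (* With i and j exchanged, [parallel_faces_opposite] would make (i, ~~ a) parallel too. *)
  move=> _ db; apply: npia; have pj' : parallel_faces (i, a) (j, ~~ b).
    by rewrite (_ : ~~ b = d) //; move: db; case: (d); case: (b).
  apply: (parallel_faces_trans pj); apply: (@parallel_faces_opposite j i) => //.
    exact: parallel_faces_trans (parallel_faces_sym pj) pj'.
  exact: parallel_faces_sym.
(* Only direction i occurs, so the additional face is the opposite one. *)
have yE : y = (i, ~~ a).
  case: y yx yimg => j b yx yimg; have [jE|ji] := eqVneq j i; last first.
    by case: none; exists j, b.
  by rewrite jE in yx *; congr (_, _); move: yx; case: (a); case: (b).
have pia : parallel_faces (i, a) (i, ~~ a) by rewrite -yE.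
rewrite (pD1 _ (i, a)) ?asboolT // (pD1 _ (i, ~~ a)); last first.
  by rewrite asboolT //= xpair_eqE eqxx; case: (a).
rewrite addrA big_pred0 => [|[k d]].
  by rewrite addr0; case: (parallel_faces_same rig pia).
apply/negP => /andP[/andP[/asboolP pk]]; rewrite !xpair_eqE.
have [_ /=|ki] := eqVneq k i; first by case: (a); case: (d).
by case: none; exists k, d.
Qed.

(** Noninjective faces contribute 0 and the others are grouped by image; quasimonophobia gives every
    group a second member. *)
Theorem noninjective_boundary : quasimonophobic n G ->
  (forall u : singular_cube G n, ~ injective u -> c u = 0) -> ~ injective t ->
  \sum_(i < n.+1) (c (singular_face i false t) - c (singular_face i true t)) *~
    (-1) ^+ i.+1 = 0.
Proof.
move=> qm c0 t_ninj.
transitivity (\sum_x face_term x).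
  rewrite -(pair_big predT predT (fun i a => face_term (i, a))) /=.
  apply: eq_bigr => i _; rewrite big_bool /face_term /= addn1 addn0.
  by rewrite [in RHS]exprS mulN1r mulrNz mulrzBl addrC.
rewrite (bigID (fun x => `[< injective (tface x) >])) /=.
rewrite [X in _ + X]big1 ?addr0; last first.
  by move=> x /asboolPn nx; rewrite /face_term c0 // mul0rz.
apply: (@sum_over_classes _ _ (fun x => injective (tface x)) parallel_faces).
- by [].
- exact: parallel_faces_sym.
- exact: parallel_faces_trans.
- by move=> x y /parallel_faces_sym[].
move=> x x_inj; have [rig qmx] := qm _ (image_is_cube x_inj).
apply: sum_parallel_faces => //.
have [j [b [jb img]]] := qmx t t_ninj x.1 x.2 (erefl _).
by exists (j, b); split=> // jbx; apply: jb; rewrite jbx; case: (x).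
Qed.

End NoninjectiveBoundary.

(** * Cells of the CW complex *)

Section CellChains.
Variables (R : realType) (G : graph).
Local Notation cube m := (solid_cube R m).
Local Notation N Y n := (normalized_complex (top_cubes R Y) n).

Definition cw_cell n (s : injective_cube G n) : top_cube R (cw R G) n :=
  characteristic (@cw_rel R G) s.

Lemma cw_cell_face n i a (s : injective_cube G n.+1) :
  cw_cell (injective_face i a s) = top_face i a (cw_cell s).
Proof.
by apply/continuousEP => p; apply/glue_piP; apply: rst_step; exact: CWFace.
Qed.

Lemma cw_cell_symmetry n g b (s : injective_cube G n) :
  cw_cell (injective_symmetry g b s) =
  top_push_cube (cw_cell s) (symmetry_cube R g b).
Proof.
by apply/continuousEP => p; apply/glue_piP; apply: rst_step; exact: CWSymmetry.
Qed.

(** [insub] succeeds exactly on injective cubes; all others are sent to 0. *)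
Definition subdivided_cell n (u : singular_cube G n) : N (cw R G) n :=
  if insub u is Some s
  then natural_chain (subdivision R) (cw R G) n << cw_cell s >> else 0.

Lemma subdivided_cellE n (s : injective_cube G n) :
  subdivided_cell (val s) = natural_chain (subdivision R) (cw R G) n << cw_cell s >>.
Proof. by rewrite /subdivided_cell valK. Qed.

Lemma subdivided_cell0 n (u : singular_cube G n) :
  ~ injective u -> subdivided_cell u = 0.
Proof. by move=> u_ninj; rewrite /subdivided_cell insubN //; apply/asboolPn. Qed.

Lemma subdivided_cell_symmetry n (u : singular_cube G n) s b : injective u ->
  subdivided_cell (graph_comp u (symmetry_graph_map s b)) =
  subdivided_cell u *~ (-1) ^+ (s + \sum_i b i)%N.
Proof.
move=> /asboolT u_inj; pose u' : injective_cube G n := exist _ u u_inj.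
rewrite (subdivided_cellE u') (subdivided_cellE (injective_symmetry s b u')).
rewrite cw_cell_symmetry !natural_chainU -raddfMz -subdivision_symmetry.
exact: push_comp.
Qed.

Definition cell_chain n : {additive free_complex (singular_cubes G) n -> N (cw R G) n} :=
  zlift (@subdivided_cell n).

Lemma cell_chainU n (u : singular_cube G n) : cell_chain n << u >> = subdivided_cell u.
Proof. exact: zliftU. Qed.

(** A degenerate cube has two equal opposite faces, so it is not injective. *)
Lemma cell_chain_degenerate n (z : free_complex (singular_cubes G) n) :
  z \in degenerate_chains (discrete_cubes G) n -> cell_chain n z = 0.
Proof.
apply: (zlift_degenerate (K := discrete_cubes G)).
case: n {z} => // n u [i ui]; apply: subdivided_cell0 => u_inj.
have : u (insert_coord i false (fun=> false)) = u (insert_coord i true (fun=> false)).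
  by have := congr1 (fun g : singular_cube G n => g (fun=> false)) ui.
by move=> /u_inj/(congr1 (@^~ i)); rewrite !insert_coord_eq.
Qed.

(** Injective cubes are handled by [subdivision_bd], noninjective ones by
    [noninjective_boundary]. *)
Lemma cell_chain_bd n : quasimonophobic n G ->
  forall y : free_complex (singular_cubes G) n.+1,
  cell_chain n (bd _ y) =
  bd (normalized_complex (top_cubes R (cw R G))) (cell_chain n.+1 y).
Proof.
move=> qm y.
apply: (free_lift_ext (f := cell_chain n \o bd (free_complex (singular_cubes G)))
  (g := bd (normalized_complex (top_cubes R (cw R G))) \o cell_chain n.+1)) => t.
change (cell_chain n (bd (free_complex (singular_cubes G)) << t >>) =
  bd (normalized_complex (top_cubes R (cw R G))) (cell_chain n.+1 << t >>)).
rewrite free_chain_bdU (raddf_cube_boundary (cell_chain n)) [in RHS]cell_chainU.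
under eq_bigr => i _ do rewrite !cell_chainU.
have [/asboolT t_inj|t_ninj] := pselect (injective t); last first.
  rewrite subdivided_cell0 // raddf0.
  apply: (noninjective_boundary _ qm) t_ninj; last exact: subdivided_cell0.
  exact: subdivided_cell_symmetry.
pose t' : injective_cube G n.+1 := exist _ t t_inj.
rewrite (subdivided_cellE t') (subdivision_bd << cw_cell t' >>) free_chain_bdU.
rewrite (raddf_cube_boundary (natural_chain (subdivision R) (cw R G) n)).
apply: eq_bigr => i _.
have fE a : subdivided_cell (face (singular_cubes G) i a t) =
    natural_chain (subdivision R) (cw R G) n
      << face (top_singular_cubes R (cw R G)) i a (cw_cell t') >>.
  by rewrite (subdivided_cellE (injective_face i a t')) cw_cell_face.
by rewrite !fE.
Qed.

End CellChains.

(** * Passage to homology classes *)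

Lemma homology_mapE (C D : chain_complex) (f : chain_map C D) n (z : cycle_group C n) :
  homology_map f n (homology_class z) = homology_class (Defs.cycle_map f z).
Proof. exact: (quot_map_pi (@cycle_map_boundary C D f n)). Qed.

Lemma homology_class_eq0 (C : chain_complex) n (z : cycle_group C n) :
  homology_class z = 0 <-> exists y : C n.+1, bd C y = val z.
Proof.
have -> : homology_class z = 0 <-> z \in boundaries C n.
  rewrite -[z in z \in _]subr0 Quotient.idealrBE; split=> [z0|/eqP z0].
    by apply/eqP; rewrite [LHS]z0; symmetry; exact: raddf0.
  by rewrite /homology_class z0; exact: raddf0.
by split=> /asboolP.
Qed.

Theorem theorem6p5 (R : realType) (n : nat)
    (X : semicubical)
    (simpleX : simple_skeleton X)
    (regularX : regular R X)
    (cubesX : cells_determined_by_cubes simpleX)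
    (x : cycle_group (free_complex X) n)
    (G : graph) (G_quasimonophobic : quasimonophobic n G)
    (alpha : graph_map (skeleton simpleX) G) (alpha_inj : injective alpha) :
  top_homology_map (cw_map R alpha_inj) n (cw_class simpleX regularX x) <> 0 ->
  graph_homology_map alpha n (graph_class simpleX x) <> 0.
Proof.
have topE : top_homology_map (cw_map R alpha_inj) n (cw_class simpleX regularX x) =
    homology_class (Defs.cycle_map (normalized_map (top_push R (cw_map R alpha_inj)))
      (Defs.cycle_map (normalized_map (top_push R (realization_to_cw simpleX regularX)))
        (Defs.cycle_map (chain_map_comp (normalization (top_cubes R (realization R X)))
          (free_chain_map (characteristic_cubes R X))) x))).
  rewrite -homology_mapE; apply: (congr1 (top_homology_map (cw_map R alpha_inj) n)).
  rewrite -homology_mapE.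
  apply: (congr1 (top_homology_map (realization_to_cw simpleX regularX) n)).
  exact: homology_mapE.
(* By contraposition, a chain y bounding in G is turned into one bounding in the CW complex. *)
rewrite {}topE; apply: contra_not; rewrite /graph_homology_map /graph_class !homology_mapE.
move=> /homology_class_eq0[y yE].
apply/homology_class_eq0.
pose w := free_chain_map (top_push R (cw_map R alpha_inj)) n
  (free_chain_map (top_push R (realization_to_cw simpleX regularX)) n
    (free_chain_map (characteristic_cubes R X) n (val x))).
pose z := free_chain_map (push_cubes alpha) n
  (free_chain_map (cell_cubes simpleX) n (val x)).
(* On a cell s, both sides subdivide the characteristic map of the cell of alpha(s). *)
have zw : cell_chain R G n z = natural_chain (subdivision R) (cw R G) n w.
  apply: (free_lift_ext
    (f := cell_chain R G n \o free_chain_map (push_cubes alpha) n \o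
          free_chain_map (cell_cubes simpleX) n)
    (g := natural_chain (subdivision R) (cw R G) n \o
          free_chain_map (top_push R (cw_map R alpha_inj)) n \o
          free_chain_map (top_push R (realization_to_cw simpleX regularX)) n \o
          free_chain_map (characteristic_cubes R X) n)) => s.
  rewrite /= !free_mapU cell_chainU.
  rewrite (subdivided_cellE R
    (push_injective alpha_inj (cell_injective_cube simpleX regularX s))).
  congr (natural_chain _ _ _ << _ >>); apply/continuousEP => p.
  have toCW : realization_to_cw simpleX regularX (characteristic_map R s p) =
      cw_cell R (cell_injective_cube simpleX regularX s) p.
    exact: (glue_map_pi (@cell_injective_cube_rel R X simpleX regularX)).
  change (cw_cell R (push_injective alpha_inj (cell_injective_cube simpleX regularX s)) p =
    cw_map R alpha_inj (realization_to_cw simpleX regularX (characteristic_map R s p))).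
  by rewrite toCW; symmetry; exact: (glue_map_pi (@push_injective_rel R _ _ _ alpha_inj)).
(* For an unnormalized lift y', the boundary equals z only up to degenerate chains, which
   [cell_chain] kills. *)
have [y' y'E] := normalization_surj y; rewrite {}y'E -chain_map_bd in yE.
have bz : cell_chain R G n (bd _ y') = cell_chain R G n z.
  apply/eqP; rewrite -subr_eq0 -raddfB; apply/eqP/cell_chain_degenerate.
  apply: normalization_eq0; apply/eqP; rewrite raddfB subr_eq0; apply/eqP.
  rewrite [LHS]yE; exact: (normalized_mapE (discrete_push alpha)).
have w_cycle : is_cycle (C := free_complex _) w.
  exact: (valP (Defs.cycle_map (free_chain_map (top_push R (cw_map R alpha_inj)))
    (Defs.cycle_map (free_chain_map (top_push R (realization_to_cw simpleX regularX)))
      (Defs.cycle_map (free_chain_map (characteristic_cubes R X)) x)))).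
(* The first term bounds the subdivision of w; the second bounds the difference between the class of
   w and its subdivision. *)
exists (cell_chain R G n.+1 y' + natural_chain (subdivision_homotopy R) (cw R G) n w).
rewrite raddfD -cell_chain_bd // bz zw -cycle_homotopy // /w.
rewrite -(normalized_mapE (top_push R (cw_map R alpha_inj))).
by rewrite -(normalized_mapE (top_push R (realization_to_cw simpleX regularX))).
Qed.
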